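(* For every $\delta\in[0,1)$ and every $\alpha\in(\delta/3,1/3)$ there exists $\epsilon>0$ with the following property. For all constants $0<c_1\le c_2$ there are $C>0$ and $n_0$ such that for all $n\ge n_0$, setting $N=2n-2$, for every prime $p$ with $c_1N^\alpha\le p\le c_2N^\alpha$, every real $k\ge1$ and bias $b$ with $H(B_b)=1/k$, every integer $\ell\le kN+N^\delta$ and every $(\epsilon\log N)^{1/2}$-local function $f:\{0,1\}^\ell\to\{0,1\}^{N+1}$, $$\Delta\big(f(B_b^{\otimes\ell}),\,(Z,\mathrm{pmmajmod}_p(Z))\big)\ \ge\ \tfrac12-\tfrac{C}{\log N},$$ where $Z$ is uniform on $\{0,1\}^N$.
   Context: $B_b$ ($b\in[-1/2,1/2]$) is the Bernoulli random variable equal to $0$ with probability $1/2+b$ and $1$ with probability $1/2-b$; $H(B_b)$ is its binary entropy (in bits); $B_b^{\otimes\ell}$ is $\ell$ i.i.d. copies. Binary tree $B_n$: vertices $v_0,\dots,v_{n-1}$, root $v_0$; for $i\ge1$ the parent of $v_i$ is $v_{\lfloor(i-1)/2\rfloor}$ and $e_i$ joins $v_i$ to its parent. For $d\in\{0,1\}^{n-1}$, $h(d)_i=\bigoplus_{j:\,e_j\text{ on the path }v_0\to v_i}d_j$. For odd prime $p$ and integer $a$, $\mathrm{MM}_p(a)=0$ if $(a\bmod p)\in\{0,\dots,(p-1)/2\}$ and $1$ otherwise. For $z=(d,x)\in\{0,1\}^{n-1}\times\{0,1\}^{n-1}$, $\mathrm{pmmajmod}_p(z)=\mathrm{MM}_p(\sum_{i=1}^{n-1}x_i(-1)^{h(d)_i})\oplus\mathrm{parity}(x)$.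 A function is $d$-local if each output bit depends on at most $d$ input bits. $\Delta$ is total variation distance. *)

(* Defs.v *)
From HB Require Import structures.
From mathcomp Require Import all_boot all_order all_algebra.
From mathcomp Require Import all_classical all_reals all_analysis.
Set Implicit Arguments. Unset Strict Implicit. Unset Printing Implicit Defensive.
Import Order.TTheory GRing.Theory Num.Theory.
Local Open Scope ring_scope.

Definition xlog2x {R : realType} (t : R) : R :=
  if t == 0 then 0 else t * (ln t / ln 2).

Definition bern {R : realType} (b : R) (x : bool) : R :=
  if x then 1/2 - b else 1/2 + b.

Definition Hbern {R : realType} (b : R) : R :=
  - (xlog2x (1/2 + b) + xlog2x (1/2 - b)).

Definition bern_prod {R : realType} (b : R) (l : nat) (x : l.-tuple bool) : R :=
  \prod_(i < l) bern b (tnth x i).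

Definition push_bern {R : realType} (b : R) (l m : nat)
  (f : l.-tuple bool -> m.-tuple bool) (y : m.-tuple bool) : R :=
  \sum_(x : l.-tuple bool | f x == y) bern_prod b x.

Definition tvd {R : realType} {T : finType} (P Q : T -> R) : R :=
  (1/2) * \sum_(y : T) `|P y - Q y|.

Definition local {R : realType} (d : R) (l m : nat)
  (f : l.-tuple bool -> m.-tuple bool) : Prop :=
  forall j : 'I_m, exists S : {set 'I_l},
    (#|S|%:R <= d) /\
    forall x y : l.-tuple bool,
      (forall i, i \in S -> tnth x i = tnth y i) -> tnth (f x) j = tnth (f y) j.

(* h(d)_i for the binary tree B_n: xor of d_j over edges e_j on the path
   v_0 -> v_i; the edge e_j joins v_j to its parent v_{(j-1)/2}.
   d is given as a function of the edge index j (1-based). Fuel i suffices. *)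
Fixpoint hpath (d : nat -> bool) (fuel i : nat) : bool :=
  match fuel with
  | 0 => false
  | fuel'.+1 => if i == 0 then false else d i (+) hpath d fuel' ((i.-1)./2)
  end.
Definition htree (d : nat -> bool) (i : nat) : bool := hpath d i i.

Definition MM (p : nat) (a : int) : bool :=
  (((p.-1)./2)%:Z < (a %% p%:Z)%Z)%R.

(* pmmajmod_p on z = (d,x) in {0,1}^{n-1} x {0,1}^{n-1}, given as a bit
   sequence of length 2n-2: d_j = z[j-1], x_i = z[(n-1)+(i-1)] (1-based j,i). *)
Definition pmmajmod (p n : nat) (z : seq bool) : bool :=
  let d := fun j : nat => nth false z j.-1 in
  let x := fun i : nat => nth false z (n.-1 + i.-1) in
  let s : int := \sum_(1 <= i < n)
      (if x i then (if htree d i then (-1)%R else 1%R) else 0%R) in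
  MM p s (+) odd (\sum_(1 <= i < n) nat_of_bool (x i)).

Definition target {R : realType} (p n : nat) (y : (2 * n - 2).+1.-tuple bool) : R :=
  if nth false y (2 * n - 2) == pmmajmod p n (take (2 * n - 2) y)
  then ((2 : R) ^+ (2 * n - 2))^-1 else 0.
Arguments target {R} p n y.

(* Main.v *)
Require Import Defs.
From HB Require Import structures.
From mathcomp Require Import all_boot all_order all_algebra.
From mathcomp Require Import all_classical all_reals all_analysis.
From mathcomp Require Import ring lra zify.
From mathcomp Require Import finset.
Set Implicit Arguments. Unset Strict Implicit. Unset Printing Implicit Defensive.
Import Order.TTheory GRing.Theory Num.Theory.
Local Open Scope ring_scope.

(* Write [F u] for the output on the input [u].  Up to a negligible event, all
   inputs are typical, so they take about [2 ^ N] values.  Delete the inputs that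
   are read by too many vertices, by a vertex high in the tree, or by the last
   output bit, and choose among the others a large set [S] whose regions (the
   vertices below a vertex that reads the input) are pairwise disjoint.  Fix the
   inputs outside [S].  Then every output bit depends on at most one input of
   [S], and the signed sum is a constant plus a sum of independent terms, one
   for each [i] in [S], contributed by the region of [i].

   Say that [i] is hit if all vertices of its region have [x = 1] and [h = 0];
   this is the unique setting of the region that maximises its contribution.
   Since [d |-> h(d)] is a bijection, the hits are independent under the target
   distribution, which therefore has at least [m / 2] of them for some
   [m >= N ^ (1 - o(1))].  If [F u] has that many hits, then either
   - at least [m / 4] inputs of [S] are hit for both values of the input: these
     inputs do not influence the output, so such typical inputs have
     [2 ^ (N - N ^ (1 - o(1)))] images only; or
   - at least [m / 4] inputs of [S] are hit for exactly one of their values: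
     each changes the signed sum by a nonzero amount modulo [p], so the sum is
     nearly equidistributed, even after the twist by the parity, and the last
     bit is correct with probability close to [1 / 2].
   Testing for few hits, membership in the small image, or a wrong last bit
   thus separates the two distributions. *)

(** * Finite probability *)

Section FiniteProbability.
Variables (R : realFieldType) (W : finType) (P : W -> R).
Hypothesis P_ge0 : forall w, 0 <= P w.
Hypothesis P_sum1 : \sum_w P w = 1.

Definition expect (Y : W -> R) : R := \sum_w P w * Y w.

Lemma expect_cst c : expect (fun=> c) = c.
Proof. by rewrite /expect -mulr_suml P_sum1 mul1r. Qed.

Lemma expectD Y Z : expect (fun w => Y w + Z w) = expect Y + expect Z.
Proof. by rewrite /expect -big_split; apply: eq_bigr => w _; rewrite mulrDr. Qed.

Lemma expectZ c Y : expect (fun w => c * Y w) = c * expect Y.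
Proof. by rewrite /expect mulr_sumr; apply: eq_bigr => w _; rewrite mulrCA. Qed.

Lemma expect_sum (I : finType) (S : {set I}) (Y : I -> W -> R) :
  expect (fun w => \sum_(i in S) Y i w) = \sum_(i in S) expect (Y i).
Proof.
rewrite /expect exchange_big; apply: eq_bigr => w _.
by rewrite mulr_sumr.
Qed.

Lemma eq_expect Y Z : Y =1 Z -> expect Y = expect Z.
Proof. by move=> YZ; apply: eq_bigr => w _; rewrite YZ. Qed.

Lemma le_expect Y Z : (forall w, Y w <= Z w) -> expect Y <= expect Z.
Proof. by move=> YZ; apply: ler_sum => w _; rewrite ler_wpM2l. Qed.

Lemma expect_covariance Y Z :
  expect (fun w => (Y w - expect Y) * (Z w - expect Z)) =
  expect (fun w => Y w * Z w) - expect Y * expect Z.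
Proof.
transitivity (expect (fun w => (Y w * Z w + (- expect Z) * Y w) +
   ((- expect Y) * Z w + expect Y * expect Z))).
  by apply: eq_expect => w; ring.
by rewrite !expectD !expectZ expect_cst; ring.
Qed.

(** Pairwise independence kills the off-diagonal covariances, and each variance is at most the
    second moment. *)
Lemma chebyshev_sum (I : finType) (S : {set I}) (Y : I -> W -> R) (a : R) :
  0 < a ->
  (forall i j, i \in S -> j \in S -> i != j ->
     expect (fun w => Y i w * Y j w) = expect (Y i) * expect (Y j)) ->
  \sum_(w | a <= `|\sum_(i in S) Y i w - \sum_(i in S) expect (Y i)|) P w
    <= (\sum_(i in S) expect (fun w => Y i w ^+ 2)) / a ^+ 2.
Proof.
move=> a0 indep; rewrite ler_pdivlMr ?exprn_gt0//.
pose Z w := \sum_(i in S) (Y i w - expect (Y i)).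
have ZE w : \sum_(i in S) Y i w - \sum_(i in S) expect (Y i) = Z w.
  by rewrite /Z sumrB.
under eq_bigl do rewrite ZE.
apply: (@le_trans _ _ (expect (fun w => Z w ^+ 2))).
  rewrite mulr_suml big_mkcond; apply: ler_sum => w _.
  case: ifP => [aZ|_]; last by rewrite mulr_ge0 ?sqr_ge0.
  rewrite ler_wpM2l// -[leRHS]real_normK ?num_real//.
  by rewrite ler_pXn2r// nnegrE ltW.
have -> : expect (fun w => Z w ^+ 2) = \sum_(i in S) \sum_(j in S)
    (expect (fun w => Y i w * Y j w) - expect (Y i) * expect (Y j)).
  transitivity (expect (fun w => \sum_(i in S) \sum_(j in S)
    (Y i w - expect (Y i)) * (Y j w - expect (Y j)))).
    apply: eq_expect => w; rewrite expr2 /Z mulr_suml.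
    by apply: eq_bigr => i _; rewrite mulr_sumr.
  rewrite expect_sum; apply: eq_bigr => i _.
  by rewrite expect_sum; apply: eq_bigr => j _; rewrite expect_covariance.
apply: ler_sum => i iS; rewrite (bigD1 i)//= big1 ?addr0.
  rewrite (eq_expect (Z := fun w => Y i w ^+ 2)) ?lerBlDr ?lerDl ?sqr_ge0//.
by move=> j /andP[jS ji]; rewrite indep// 1?eq_sym// subrr.
Qed.

End FiniteProbability.

(** * Product measures on bit vectors *)

Section ProductMeasure.
Variables (R : realFieldType) (I : finType) (beta : bool -> R).
Hypothesis beta_ge0 : forall c, 0 <= beta c.
Hypothesis beta_sum1 : beta true + beta false = 1.

Definition prodm (u : {ffun I -> bool}) : R := \prod_i beta (u i).

Lemma prodm_ge0 u : 0 <= prodm u.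
Proof. exact: prodr_ge0. Qed.

Lemma expect_prodm_prod (A : {set I}) (c : I -> bool -> R) :
  expect prodm (fun u => \prod_(i in A) c i (u i)) =
  \prod_(i in A) (beta true * c i true + beta false * c i false).
Proof.
pose d i b := if i \in A then c i b else 1.
transitivity (\sum_(u : {ffun I -> bool}) \prod_i (beta (u i) * d i (u i))).
  by apply: eq_bigr => u _; rewrite big_split/= [X in _ * X]big_mkcond.
rewrite -(bigA_distr_bigA (fun i b => beta b * d i b)) [RHS]big_mkcond/=; apply: eq_bigr => i _.
rewrite big_bool /d; case: ifP => //= _; by rewrite !mulr1.
Qed.

Lemma prodm_sum1 : \sum_u prodm u = 1.
Proof.
have := expect_prodm_prod set0 (fun _ _ => 1).
rewrite [X in _ = X -> _]big_set0 /expect => <-; apply: eq_bigr => u _.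
by rewrite big_set0 mulr1.
Qed.

Definition mix (S : {set I}) (u w : {ffun I -> bool}) : {ffun I -> bool} :=
  [ffun i => if i \in S then w i else u i].

(* [(u, w) |-> (mix S u w, mix S w u)] is a measure-preserving involution. *)
Lemma expect_resample (S : {set I}) (phi : {ffun I -> bool} -> R) :
  expect prodm phi =
  expect prodm (fun u => expect prodm (fun w => phi (mix S u w))).
Proof.
pose sw (x : {ffun I -> bool} * {ffun I -> bool}) := (mix S x.1 x.2, mix S x.2 x.1).
have swK : involutive sw.
  move=> [u w]; rewrite /sw/=.
  by congr (_, _); apply/ffunP => i; rewrite !ffunE; case: (i \in S).
transitivity (\sum_(x : {ffun I -> bool} * {ffun I -> bool})
   prodm x.1 * prodm x.2 * phi x.1).
  rewrite -(pair_bigA _ (fun u w => prodm u * prodm w * phi u))/=.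
  apply: eq_bigr => u _; rewrite -mulr_suml -mulr_sumr prodm_sum1 mulr1//.
rewrite (reindex_inj (inv_inj swK))/=.
rewrite -(pair_bigA _ (fun u w =>
  prodm (mix S u w) * prodm (mix S w u) * phi (mix S u w)))/=.
apply: eq_bigr => u _; rewrite mulr_sumr; apply: eq_bigr => w _.
rewrite mulrA; congr (_ * _); rewrite /prodm -!big_split/=.
by apply: eq_bigr => i _; rewrite !ffunE; case: ifP => // _; rewrite mulrC.
Qed.

Lemma prodm_cylinder (A : {set I}) (u : {ffun I -> bool}) :
  \sum_(v : {ffun I -> bool} | [forall i in ~: A, v i == u i]) prodm v =
  \prod_(i in ~: A) beta (u i).
Proof.
have := expect_prodm_prod (~: A) (fun i b => (b == u i)%:R).
rewrite /expect [in X in _ = X -> _](eq_bigr (fun i => beta (u i))); last first.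
  by move=> i _; case: (u i); rewrite /= !(mulr1, mulr0) ?addr0 ?add0r.
move=> <-; rewrite big_mkcond; apply: eq_bigr => v _.
case: ifP => [/forall_inP H|/negbT].
  by rewrite big1 ?mulr1// => i iA; rewrite H.
rewrite negb_forall_in => /exists_inP[i iA /negbTE vi].
by rewrite (bigD1 i)//= vi mul0r mulr0.
Qed.

(* If [f] is constant on a cylinder of mass at least [c] around every point of
   [G], then every value in [f @: G] has mass at least [c]. *)
Lemma card_imset_cylinder (T : finType) (f : {ffun I -> bool} -> T)
    (G : {set {ffun I -> bool}}) (A : {ffun I -> bool} -> {set I}) (c : R) :
  (forall u v : {ffun I -> bool}, u \in G -> (forall i, i \notin A u -> v i = u i) -> f v = f u) ->
  (forall u, u \in G -> c <= \prod_(i in ~: A u) beta (u i)) ->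
  #|f @: G|%:R * c <= 1.
Proof.
move=> fA cA; rewrite mulr_natl -sumr_const.
apply: (@le_trans _ _ (\sum_(t in f @: G) \sum_(u | f u == t) prodm u)).
  apply: ler_sum => _ /imsetP[u uG ->]; apply: le_trans (cA _ uG) _.
  rewrite -prodm_cylinder [leLHS]big_mkcond [leRHS]big_mkcond.
  apply: ler_sum => v _; case: ifP => [/forall_inP vu|_].
    by rewrite (fA u v)// ?eqxx// => i iA; apply/eqP/vu; rewrite inE.
  by case: ifP => // _; apply: prodm_ge0.
apply: (@le_trans _ _ (\sum_(t : T) \sum_(u | f u == t) prodm u)).
  rewrite [leLHS]big_mkcond; apply: ler_sum => t _; case: ifP => // _.
  by apply: sumr_ge0 => u _; apply: prodm_ge0.
by rewrite -prodm_sum1 (partition_big f xpredT).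
Qed.

End ProductMeasure.

(** * Random walks modulo a prime *)

Section CyclicContraction.
Variables (R : realFieldType) (p : nat).
Hypothesis p_pr : prime p.

Lemma sumr_cstl (J : finType) (S : {pred J}) (c : R) :
  \sum_(j in S) c = #|S|%:R * c.
Proof. by rewrite sumr_const mulr_natl. Qed.

Lemma cauchy_schwarz_sum (J : finType) (S : {pred J}) (x : J -> R) :
  (\sum_(j in S) x j) ^+ 2 <= #|S|%:R * \sum_(j in S) x j ^+ 2.
Proof.
rewrite expr2 mulr_suml.
apply: (@le_trans _ _ (\sum_(i in S) \sum_(j in S) (x i ^+ 2 + x j ^+ 2) / 2)).
  apply: ler_sum => i _; rewrite mulr_sumr; apply: ler_sum => j _.
  have := sqr_ge0 (x i - x j); lra.
under eq_bigr => i _ do rewrite -mulr_suml big_split/= sumr_cstl.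
by rewrite -mulr_suml big_split/= sumr_cstl -mulr_sumr; lra.
Qed.

Lemma sum_shift (g : 'F_p -> R) (a : 'F_p) : \sum_s g (s + a) = \sum_s g s.
Proof. by rewrite [RHS](reindex_inj (addIr a)). Qed.

(** As [p] is prime and [a] nonzero, [s + j * a] for [j < p] meets every residue exactly once. *)
Lemma sum_line (phi : 'F_p -> R) (s a : 'F_p) : a != 0 ->
  \sum_(j < p) phi (s + j%:R * a) = \sum_t phi t.
Proof.
move=> a0; rewrite [RHS](reindex_inj (addrI s))/=.
rewrite [RHS](reindex_inj (mulIf a0))/=.
have [p0] : (0 < p)%N by apply: prime_gt0.
rewrite [RHS](reindex (fun j : 'I_p => (j%:R : 'F_p)))//=.
exists (fun t : 'F_p => insubd (Ordinal p0) (t : nat)) => [j _|t _].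
  apply: val_inj; rewrite /= val_insubd/= val_Fp_nat// modn_small//.
  by rewrite ltn_ord.
rewrite val_insubd; have := ltn_ord t; rewrite {2}Fp_cast// => ->.
by rewrite natr_Zp.
Qed.

Definition normsq (g : 'F_p -> R) : R := \sum_s g s ^+ 2.

Lemma normsq_ge0 g : 0 <= normsq g.
Proof. by apply: sumr_ge0 => s _; apply: sqr_ge0. Qed.

(** Go from [s] to [t] in fewer than [p] steps of length [a], and apply Cauchy-Schwarz to the
    telescoping sum of the increments. *)
Lemma poincare_pairs (g : 'F_p -> R) (a s t : 'F_p) : a != 0 ->
  (g t - g s) ^+ 2 <= p%:R * \sum_r (g (r + a) - g r) ^+ 2.
Proof.
move=> a0.
pose m := ((t - s) / a : 'F_p) : nat.
have mp : (m <= p)%N.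
  by have := ltn_ord ((t - s) / a : 'F_p); rewrite {2}Fp_cast// => /ltnW.
have tE : t = s + m%:R * a by rewrite /m natr_Zp divfK// addrC subrK.
pose x j := g (s + j.+1%:R * a) - g (s + j%:R * a).
have -> : g t - g s = \sum_(j < m) x j.
  rewrite -(big_mkord xpredT) telescope_sumr//.
  by rewrite mul0r addr0 -tE.
apply: le_trans (cauchy_schwarz_sum _ _) _.
rewrite card_ord; apply: ler_pM; rewrite ?ler_nat// ?sumr_ge0//.
  by move=> j _; apply: sqr_ge0.
rewrite -(sum_line _ s a0) (big_ord_widen _ (fun j => x j ^+ 2) mp) big_mkcond.
apply: ler_sum => j _; case: ifP => _; last exact: sqr_ge0.
by rewrite /x -addrA -natr1 mulrDl mul1r.
Qed.

(** A spectral gap for the cycle of step [a]: sum [poincare_pairs] over all pairs; for mean zero the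
    left side becomes [2 * p * normsq g]. *)
Lemma poincare_cycle (g : 'F_p -> R) (a : 'F_p) : a != 0 -> \sum_s g s = 0 ->
  2 * normsq g <= p%:R ^+ 2 * \sum_r (g (r + a) - g r) ^+ 2.
Proof.
move=> a0 g0; set D := \sum_r _.
have p0 : 0 < (p%:R : R) by rewrite ltr0n prime_gt0.
have H : \sum_s \sum_t (g t - g s) ^+ 2 <= \sum_(s : 'F_p) \sum_(t : 'F_p) p%:R * D.
  by apply: ler_sum => s _; apply: ler_sum => t _; apply: poincare_pairs.
have HL : \sum_s \sum_t (g t - g s) ^+ 2 = p%:R * (2 * normsq g).
  transitivity (\sum_s (normsq g - 2 * g s * \sum_t g t + p%:R * g s ^+ 2)).
    apply: eq_bigr => s _.
    transitivity (\sum_t (g t ^+ 2 + (- (2 * g s * g t)) + g s ^+ 2)).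
      by apply: eq_bigr => t _; ring.
    rewrite !big_split/= sumrN -mulr_sumr sumr_cstl card_Fp//.
  rewrite g0; under eq_bigr do rewrite mulr0 subr0.
  rewrite big_split/= sumr_cstl card_Fp// -mulr_sumr /normsq; ring.
move: H; rewrite HL !sumr_cstl !card_Fp// ler_pM2l// mulrA.
by rewrite -expr2.
Qed.

(* The alternating sum of the [p] consecutive values [g (s+ja) + g (s+(j+1)a)]
   telescopes to [2 g s], because [p] is odd. *)
Lemma poincare_alternating (g : 'F_p -> R) (a : 'F_p) : odd p -> a != 0 ->
  4 * normsq g <= p%:R ^+ 2 * \sum_r (g (r + a) + g r) ^+ 2.
Proof.
move=> p_odd a0; set D := \sum_r _.
have H s : 4 * g s ^+ 2 <= p%:R * D.
  pose x j := (-1) ^+ j * (g (s + j.+1%:R * a) + g (s + j%:R * a)).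
  have <- : (\sum_(j < p) x j) ^+ 2 = 4 * g s ^+ 2.
    rewrite -(big_mkord xpredT x).
    have -> : \sum_(0 <= j < p) x j = - \sum_(0 <= j < p)
        ((-1) ^+ j.+1 * g (s + j.+1%:R * a) - (-1) ^+ j * g (s + j%:R * a)).
      by rewrite -sumrN; apply: eq_bigr => j _; rewrite /x exprS; ring.
    rewrite telescope_sumr// pchar_Fp_0// mul0r addr0 -signr_odd p_odd expr0.
    ring.
  apply: le_trans (cauchy_schwarz_sum _ _) _.
  rewrite card_ord ler_wpM2l ?ler0n// /D -(sum_line _ s a0).
  apply: ler_sum => j _; rewrite /x exprMn sqrr_sign mul1r.
  by rewrite -addrA -natr1 mulrDl mul1r.
have : \sum_(s : 'F_p) 4 * g s ^+ 2 <= \sum_(s : 'F_p) p%:R * D.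
  by apply: ler_sum => s _.
by rewrite -mulr_sumr sumr_cstl card_Fp// mulrA -expr2.
Qed.

(* One step of the walk; [sg c] records the parity of the step. *)
Definition walk_step (beta : bool -> R) (sg : bool -> bool) (a : bool -> 'F_p)
    (g : 'F_p -> R) (s : 'F_p) : R :=
  \sum_c beta c * (-1) ^+ sg c * g (s + a c).

(** The step combines two signed translates [f1], [f2] of [g], both of the norm of [g], so [|x f1 +
    y f2|^2 = (x + y)^2 |g|^2 - x y |f1 - f2|^2]. *)
Lemma normsq_walk_step beta sg a g :
  normsq (walk_step beta sg a g) =
  (beta true + beta false) ^+ 2 * normsq g -
  beta true * beta false * \sum_s
    (g (s + (a true - a false)) - (-1) ^+ (sg true (+) sg false) * g s) ^+ 2.
Proof.
set e := (-1) ^+ _.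
have sge c : (-1 : R) ^+ sg c * (-1) ^+ sg c = 1 by rewrite -expr2 sqrr_sign.
have sgm : (-1 : R) ^+ sg true * (-1) ^+ sg false = e by rewrite -signr_addb.
have e2 : e ^+ 2 = 1 by rewrite sqrr_sign.
have st : \sum_s g (s + a true) ^+ 2 = normsq g by exact: (sum_shift (fun s => g s ^+ 2)).
have sf : \sum_s g (s + a false) ^+ 2 = normsq g by exact: (sum_shift (fun s => g s ^+ 2)).
pose X := \sum_s g (s + a true) * g (s + a false).
have -> : \sum_s (g (s + (a true - a false)) - e * g s) ^+ 2 =
    2 * normsq g - 2 * e * X.
  rewrite -(sum_shift (fun s => (g (s + (a true - a false)) - e * g s) ^+ 2) (a false)).
  transitivity (\sum_s (g (s + a true) ^+ 2 + g (s + a false) ^+ 2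
      + (- (2 * e)) * (g (s + a true) * g (s + a false)))).
    apply: eq_bigr => s _; rewrite -addrA subrKC.
    have -> u v : (u - e * v) ^+ 2 = u ^+ 2 + e ^+ 2 * v ^+ 2 + - (2 * e) * (u * v).
      by ring.
    by rewrite e2 mul1r.
  by rewrite !big_split/= -mulr_sumr st sf -/X; ring.
transitivity (beta true ^+ 2 * normsq g + beta false ^+ 2 * normsq g
   + 2 * beta true * beta false * e * X); last by ring.
rewrite -{1}st -{1}sf /X !mulr_sumr -!big_split/=; apply: eq_bigr => s _.
rewrite /walk_step big_bool/= -sgm.
move: (sge true) (sge false); set w := (-1) ^+ sg true; set v := (-1) ^+ sg false.
move=> ww vv.
transitivity (beta true ^+ 2 * (w * w) * g (s + a true) ^+ 2 +
  beta false ^+ 2 * (v * v) * g (s + a false) ^+ 2 +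
  2 * beta true * beta false * (w * v) * (g (s + a true) * g (s + a false))).
  by ring.
by rewrite ww vv; ring.
Qed.

Lemma sum_walk_step beta sg a g : \sum_s g s = 0 ->
  \sum_s walk_step beta sg a g s = 0.
Proof.
move=> g0; rewrite /walk_step exchange_big big1// => c _.
by rewrite -mulr_sumr sum_shift g0 mulr0.
Qed.

Lemma walk_step_le beta sg a g : 0 <= beta true * beta false ->
  beta true + beta false = 1 ->
  normsq (walk_step beta sg a g) <= normsq g.
Proof.
move=> b0 b1; rewrite normsq_walk_step b1 expr1n mul1r gerBl mulr_ge0//.
by apply: sumr_ge0 => s _; apply: sqr_ge0.
Qed.

(** The loss in norm is a Dirichlet form of step [a true - a false]. It is bounded below by
    [poincare_cycle] if the two parities agree, and by [poincare_alternating] otherwise. *)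
Lemma walk_step_contract beta sg a g : odd p -> 0 <= beta true * beta false ->
  beta true + beta false = 1 -> a true != a false -> \sum_s g s = 0 ->
  normsq (walk_step beta sg a g) <=
    (1 - 2 * (beta true * beta false) / p%:R ^+ 2) * normsq g.
Proof.
move=> p_odd b0 b1 neqa g0; rewrite normsq_walk_step b1 expr1n mul1r mulrBl mul1r.
rewrite lerB//.
have p0 : 0 < (p%:R ^+ 2 : R) by rewrite exprn_gt0// ltr0n prime_gt0.
have a0 : a true - a false != 0 by rewrite subr_eq0.
set D := \sum_s _; set c := beta true * beta false.
have -> : 2 * c / p%:R ^+ 2 * normsq g = c * ((p%:R ^+ 2)^-1 * (2 * normsq g)).
  by move: (normsq g) c ((p%:R ^+ 2)^-1 : R) => x y z; ring.
rewrite ler_wpM2l// ler_pdivrMl// /D.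
case: (_ (+) _) => /=.
  have := poincare_alternating g p_odd a0; have := normsq_ge0 g.
  rewrite expr1; under [in X in _ -> _ -> X]eq_bigr do rewrite mulN1r opprK.
  lra.
under eq_bigr do rewrite expr0 mul1r.
exact: poincare_cycle.
Qed.

End CyclicContraction.

(** * Regions of the binary tree *)

Section TreeBits.

(** Needed for [htree_parent]: the recursion leaves fuel [i - 1] for the parent, whereas [htree]
    gives it its own index. *)
Lemma hpath_fuel (d : nat -> bool) (f1 f2 i : nat) :
  (i <= f1)%N -> (i <= f2)%N -> hpath d f1 i = hpath d f2 i.
Proof.
elim: f1 f2 i => [|f1 IH] [|f2] i //=.
- by rewrite leqn0 => /eqP-> _.
- by move=> _; rewrite leqn0 => /eqP->.
move=> i1 i2; case: eqP => // /eqP i0; congr (_ (+) _).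
by apply: IH; lia.
Qed.

Lemma htree0 d : htree d 0 = false.
Proof. by []. Qed.

Lemma htree_parent d i : (0 < i)%N -> htree d i = d i (+) htree d (i.-1)./2.
Proof.
case: i => // i _; rewrite /htree [LHS]/=; congr (_ (+) _).
by apply: hpath_fuel; lia.
Qed.

Definition hb (y : seq bool) (w : nat) : bool :=
  htree (fun j => nth false y j.-1) w.
Definition xb (n : nat) (y : seq bool) (w : nat) : bool :=
  nth false y (n.-1 + w.-1).

Definition sval (n : nat) (y : seq bool) (w : nat) : int :=
  if xb n y w then (if hb y w then -1 else 1) else 0.

End TreeBits.

Section Regions.
Variables (I : finType) (n r : nat) (dep : nat -> {set I}).

(** The inputs read by the two output bits of vertex [w]: its edge bit in [d] and its bit in [x]. *)
Definition depv (w : nat) : {set I} := dep w.-1 :|: dep (n.-1 + w.-1).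

(* The vertices lying less than [r] levels below a vertex that reads input [i];
   with indices shifted by one, the [j]-th ancestor is the quotient by [2 ^ j]. *)
Definition region (i : I) : {set 'I_n} :=
  [set w : 'I_n | (0 < w)%N && [exists j : 'I_r, exists v : 'I_n,
     [&& (0 < v)%N, i \in depv v & (w.+1 %/ 2 ^ j == v.+1)%N]]].

(** With indices shifted by one, the descendants of [v] at depth [r] start at [2 ^ r * v.+1]. The
    condition says that none exists, so truncating the region at [r] levels cuts nothing and the
    region is closed under children. *)
Definition low (i : I) : Prop :=
  forall v : nat, (0 < v < n)%N -> i \in depv v -> (n < 2 ^ r * v.+1)%N.

Lemma region_touched i (w : 'I_n) : (0 < r)%N -> (0 < w)%N -> i \in depv w ->
  w \in region i.
Proof.
move=> r0 w0 iw; rewrite inE w0/=; apply/existsP; exists (Ordinal r0).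
by apply/existsP; exists w; rewrite w0 iw /= expn0 divn1 eqxx.
Qed.

Lemma region_child i (w w' : 'I_n) : low i -> (0 < w')%N ->
  w = (w'.-1)./2 :> nat -> w \in region i -> w' \in region i.
Proof.
move=> li w'0 ww'; rewrite !inE w'0 => /andP[w0 /existsP[j /existsP[v]]].
move=> /and3P[v0 iv /eqP jv] /=.
have w1 : w.+1 = (w'.+1 %/ 2)%N by rewrite ww'; lia.
have w2 : (w'.+1 %/ 2 ^ j.+1)%N = v.+1 by rewrite expnS divnMA -w1.
have ltn_v : (n < 2 ^ r * v.+1)%N by apply: li; rewrite ?v0 ?ltn_ord.
have jr : (j.+1 < r)%N.
  rewrite ltnNge; apply/negP => rj.
  have := leq_trunc_div w'.+1 (2 ^ j.+1); rewrite w2.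
  have : (2 ^ r * v.+1 <= 2 ^ j.+1 * v.+1)%N by rewrite leq_mul2r leq_exp2l// rj orbT.
  by have := ltn_ord w'; rewrite mulnC; lia.
apply/existsP; exists (Ordinal jr); apply/existsP; exists v.
by rewrite v0 iv /= w2 eqxx.
Qed.

Lemma region_gt0 i (w : 'I_n) : w \in region i -> (0 < w)%N.
Proof. by rewrite inE => /andP[]. Qed.

End Regions.

Section Blocks.
Variables (I : finType) (n r : nat) (dep : nat -> {set I}).
Variable F : {ffun I -> bool} -> seq bool.
Hypothesis dep_ok : forall j (u v : {ffun I -> bool}),
  (forall i, i \in dep j -> u i = v i) -> nth false (F u) j = nth false (F v) j.
Hypothesis r_gt0 : (0 < r)%N.
Variable S : {set I}.
Hypothesis S_low : forall i, i \in S -> low n r dep i.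
Hypothesis S_disj : forall i j, i \in S -> j \in S -> i != j ->
  [disjoint region n r dep i & region n r dep j].
Hypothesis S_last : forall i, i \in S -> i \notin dep (2 * n - 2).

Local Notation region := (region n r dep).
Local Notation ffb := {ffun I -> bool}.

(** A change of the inputs in [A] stays inside their regions. This is clear for the bits read
    directly; for [h], follow the path to the root: by [region_child], the parent of a vertex
    outside the regions is the root or again outside. *)
Lemma bits_agree (A : {set I}) (u v : ffb) (w : 'I_n) : A \subset S ->
  (forall i, i \notin A -> u i = v i) ->
  (forall i, i \in A -> w \notin region i) -> (0 < w)%N ->
  [/\ nth false (F u) w.-1 = nth false (F v) w.-1,
      xb n (F u) w = xb n (F v) w & hb (F u) w = hb (F v) w].
Proof.
move=> AS uv.
have base (w' : 'I_n) : (forall i, i \in A -> w' \notin region i) -> (0 < w')%N ->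
    nth false (F u) w'.-1 = nth false (F v) w'.-1 /\ xb n (F u) w' = xb n (F v) w'.
  move=> wA w0.
  have dA i : i \in depv n dep w' -> u i = v i.
    move=> iw; apply: uv; apply/negP => /wA/negP; apply.
    exact: region_touched.
  by split; apply: dep_ok => i iw; apply: dA; rewrite inE iw ?orbT.
case: w => w; elim/ltn_ind: w => w IH wn wA w0.
have [bd bx] := base (Ordinal wn) wA w0; split => //.
rewrite /hb (htree_parent (fun j => nth false (F u) j.-1) w0).
rewrite (htree_parent (fun j => nth false (F v) j.-1) w0).
congr (_ (+) _); first exact: bd.
have [->|p0] := posnP (w.-1)./2; first by rewrite !htree0.
have pw : ((w.-1)./2 < w)%N by rewrite /= in w0; lia.
have pn : ((w.-1)./2 < n)%N by rewrite (ltn_trans pw).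
have [] := IH _ pw pn => // i iA; apply/negP => pr.
have /negP := wA i iA; apply; apply: region_child pr => //.
by apply: S_low; apply: (fintype.subsetP AS).
Qed.

Lemma region_uniq i j (w : 'I_n) : i \in S -> j \in S ->
  w \in region i -> w \in region j -> i = j.
Proof.
move=> iS jS wi wj; apply/eqP; apply: contraT => ij.
by have /disjointFr/(_ wi) := S_disj iS jS ij; rewrite wj.
Qed.

Lemma bits_outside (u v : ffb) (w : 'I_n) :
  (forall i, i \notin S -> u i = v i) ->
  (forall i, i \in S -> w \notin region i) -> (0 < w)%N ->
  xb n (F u) w = xb n (F v) w /\ hb (F u) w = hb (F v) w.
Proof.
by move=> uv wS w0; have [] := bits_agree (subxx S) uv wS w0.
Qed.

(** As [w] lies in no other region, the inputs of [S] other than [i] do not reach it. *)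
Lemma bits_region (u v : ffb) (i : I) (w : 'I_n) : i \in S ->
  (forall j, j \notin S -> u j = v j) -> u i = v i ->
  w \in region i ->
  xb n (F u) w = xb n (F v) w /\ hb (F u) w = hb (F v) w.
Proof.
move=> iS uv ui wi.
have [] := @bits_agree (S :\ i) u v w => //.
- exact: subD1set.
- move=> j; rewrite in_setD1 negb_and negbK => /orP[/eqP->//|]; exact: uv.
- move=> j /setD1P[ji jS]; apply/negP => wj.
  by move/eqP: ji; apply; apply: region_uniq wj wi.
- exact: region_gt0 wi.
Qed.

Definition setc (u : ffb) (i : I) (c : bool) : ffb :=
  [ffun j => if j == i then c else u j].

Definition hit (y : seq bool) (i : I) : bool :=
  [forall w in region i, xb n y w && ~~ hb y w].

Definition hitc (u : ffb) (i : I) (c : bool) : bool := hit (F (setc u i c)) i.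

Definition swing (u : ffb) : {set I} := [set i in S | hitc u i true != hitc u i false].
Definition frozen (u : ffb) : {set I} := [set i in S | hitc u i true && hitc u i false].

Lemma eq_hit (u v : ffb) i : i \in S ->
  (forall j, j \notin S -> u j = v j) -> u i = v i -> hit (F u) i = hit (F v) i.
Proof.
move=> iS uv ui; apply: eq_forallb_in => w wi.
by have [-> ->] := bits_region iS uv ui wi.
Qed.

Lemma hit_hitc u i : hit (F u) i = hitc u i (u i).
Proof.
rewrite /hitc; congr (hit (F _) i).
by apply/ffunP => j; rewrite ffunE; case: eqP => [->|].
Qed.

Lemma eq_hitc (u v : ffb) i c : i \in S -> (forall j, j \notin S -> u j = v j) ->
  hitc u i c = hitc v i c.
Proof.
move=> iS uv; apply: eq_hit => // [j jS|]; last by rewrite !ffunE eqxx.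
by rewrite !ffunE uv.
Qed.

(** This permits conditioning: fixing the inputs outside [S] fixes the swing set, while the inputs
    in [S] stay random. *)
Lemma eq_swing (u v : ffb) : (forall j, j \notin S -> u j = v j) -> swing u = swing v.
Proof.
move=> uv; apply/setP => i; rewrite !inE; case: (boolP (i \in S)) => //= iS.
by rewrite !(eq_hitc _ iS uv).
Qed.

Lemma card_hit (u : ffb) :
  (#|[set i in S | hit (F u) i]| <= #|swing u| + #|frozen u|)%N.
Proof.
rewrite -cardsUI; apply: leq_trans (leq_addr _ _); apply: subset_leq_card.
apply/fintype.subsetP => i; rewrite !inE => /andP[iS]; rewrite iS/= hit_hitc.
by case: (u i); case: (hitc u i true); case: (hitc u i false).
Qed.

(** The region of a frozen input is hit whatever the input is, so [x = 1] and [h = 0] throughout it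
    before and after the change; elsewhere [bits_agree] applies. *)
Lemma frozen_cylinder (u v : ffb) :
  (forall i, i \notin frozen u -> v i = u i) ->
  forall j, (j <= 2 * n - 2)%N -> nth false (F v) j = nth false (F u) j.
Proof.
move=> vu.
have FS : frozen u \subset S by apply/fintype.subsetP => i; rewrite inE => /andP[].
have uvS i : i \notin S -> u i = v i.
  move=> iS; rewrite vu//; apply: contra iS; exact: (fintype.subsetP FS).
have bits (w : 'I_n) : (0 < w)%N ->
    xb n (F v) w = xb n (F u) w /\ hb (F v) w = hb (F u) w.
  move=> w0.
  have [/existsP[i /andP[iF wi]]|] := boolP [exists i, (i \in frozen u) && (w \in region i)].
    have iS := fintype.subsetP FS _ iF.
    move: iF; rewrite inE iS/= => /andP[ht hf].
    have hh c : hitc u i c by case: c.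
    have /forall_inP/(_ w wi)/andP[-> /negbTE->] : hit (F u) i by rewrite hit_hitc.
    have /forall_inP/(_ w wi)/andP[-> /negbTE->] // : hit (F v) i.
    by rewrite hit_hitc -(eq_hitc _ iS uvS).
  rewrite negb_exists => /forallP nw.
  have [] := bits_agree FS vu _ w0 => // i iF.
  by have := nw i; rewrite iF.
have hbits w : (w < n)%N -> hb (F v) w = hb (F u) w.
  case: w => [//|w wn]; exact: (proj2 (bits (Ordinal wn) isT)).
move=> j jN; have [jn|jn] := ltnP j n.-1.
  have wn : (j.+1 < n)%N by lia.
  (* An edge bit is the sum of the [h] bits at its two ends; position [j] holds the edge above
     vertex [j.+1], whose parent is [j./2]. *)
  have dE y : nth false y j = hb y j.+1 (+) hb y (j./2).
    by rewrite /hb htree_parent//= -addbA addbb addbF.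
  by rewrite !dE !hbits//; lia.
have [->|jN'] := eqVneq j (2 * n - 2)%N.
  apply: dep_ok => i iN; apply/esym/uvS; apply: contraL iN; exact: S_last.
have wn : ((j - n.-1).+1 < n)%N by lia.
by have [+ _] := bits (Ordinal wn) isT; rewrite /xb/= subnKC.
Qed.

Lemma last_agree (u v : ffb) : (forall i, i \notin S -> u i = v i) ->
  nth false (F u) (2 * n - 2) = nth false (F v) (2 * n - 2).
Proof.
move=> uv; apply: dep_ok => i iN; apply: uv; apply: contraL iN; exact: S_last.
Qed.

(** Every non-root vertex lies in exactly one region or in none. The operation is left general to
    serve both the signed sum and the parity. *)
Lemma big_regions (T : Type) (idx : T) (op : Monoid.com_law idx) (phi : 'I_n -> T) :
  \big[op/idx]_(w : 'I_n | (0 < w)%N) phi w =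
  op (\big[op/idx]_(w : 'I_n | (0 < w)%N && [forall i in S, w \notin region i]) phi w)
     (\big[op/idx]_(i in S) \big[op/idx]_(w in region i) phi w).
Proof.
rewrite (bigID (fun w : 'I_n => [forall i in S, w \notin region i]))/=.
congr (op _ _).
(* Empty sets outside [S] make the family pairwise disjoint over all of [I]. *)
pose G i := if i \in S then region i else set0.
transitivity (\big[op/idx]_i \big[op/idx]_(w in G i) phi w); last first.
  rewrite [RHS]big_mkcond; apply: eq_bigr => i _; rewrite /G.
  by case: ifP => // _; rewrite big_set0.
rewrite -partition_disjoint_bigcup; last first.
  move=> i j ij; rewrite /G; case: ifP => [iS|_]; last by rewrite -setI_eq0 set0I.
  case: ifP => [jS|_]; last by rewrite -setI_eq0 setI0.
  exact: S_disj.
apply: eq_bigl => w; rewrite negb_forall_in; apply/idP/idP.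
  move=> /andP[w0 /exists_inP[i iS]]; rewrite negbK => wi.
  by apply/bigcupP; exists i => //; rewrite /G iS.
move=> /bigcupP[i _]; rewrite /G; case: ifP => [iS wi|]; last by rewrite inE.
rewrite (region_gt0 wi)/=; apply/exists_inP; exists i => //; by rewrite negbK.
Qed.

Definition rsum (i : I) (y : seq bool) : int := \sum_(w in region i) sval n y w.
Definition rpar (i : I) (y : seq bool) : bool :=
  \big[addb/false]_(w in region i) xb n y w.

(** With the inputs [u] outside [S] fixed, the total is a constant combined with one term per [i] in
    [S], and that term involves [w i] only. *)
Lemma mix_decomposition (T : Type) (idx : T) (op : Monoid.com_law idx)
    (phi : bool -> bool -> T) (u w : ffb) :
  let psi y (v : 'I_n) := phi (xb n y v) (hb y v) in
  \big[op/idx]_(v : 'I_n | (0 < v)%N) psi (F (mix S u w)) v =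
  op (\big[op/idx]_(v : 'I_n | (0 < v)%N && [forall i in S, v \notin region i])
        psi (F u) v)
     (\big[op/idx]_(i in S) \big[op/idx]_(v in region i)
        psi (F (setc u i (w i))) v).
Proof.
move=> psi; rewrite big_regions; congr (op _ _).
  apply: eq_bigr => v /andP[v0 /forall_inP vS].
  have [] := @bits_outside (mix S u w) u v _ vS v0; last by rewrite /psi => -> ->.
  by move=> i /negbTE iS; rewrite ffunE iS.
apply: eq_bigr => i iS; apply: eq_bigr => v vi.
have [] := @bits_region (mix S u w) (setc u i (w i)) i v iS _ _ vi.
- move=> j jS; rewrite !ffunE (negbTE jS).
  by case: eqP => // ji; rewrite ji iS in jS.
- by rewrite !ffunE iS eqxx.
by rewrite /psi => -> ->.
Qed.

Lemma sval_le1 y w : (`|sval n y w| <= 1)%R.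
Proof. by rewrite /sval; case: ifP => // _; case: ifP. Qed.

Lemma rsum_hit i y : hit y i -> rsum i y = #|region i|%:Z.
Proof.
move=> /forall_inP H; rewrite /rsum (eq_bigr (fun=> 1)).
  by rewrite sumr_const natz.
by move=> w /H/andP[xw /negbTE hw]; rewrite /sval xw hw.
Qed.

(** Contributions lie in [[-1, 1]], and a vertex that violates the hit condition contributes at most
    [0]. *)
Lemma rsum_nohit i y : ~~ hit y i ->
  - (#|region i|%:Z) <= rsum i y < #|region i|%:Z.
Proof.
rewrite negb_forall_in => /exists_inP[w wi nw].
have E1 : #|region i|%:Z = \sum_(v in region i) 1 by rewrite sumr_const natz.
apply/andP; split.
  rewrite E1 -sumrN; apply: ler_sum => v _.
  by have := sval_le1 y v; rewrite ler_norml => /andP[].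
rewrite E1 /rsum (bigD1 w)//= [ltRHS](bigD1 w)//=; apply: ltr_leD.
  by move: nw; rewrite /sval; case: (xb n y w) => //=; case: (hb y w).
by apply: ler_sum => v _; have := sval_le1 y v; rewrite ler_norml => /andP[].
Qed.

(** Exactly one of the two sums attains the maximum [#|region i|], so they differ by at least [1]
    and at most [2 * #|region i| < p]. *)
Lemma swing_rsum (p : nat) (u : ffb) i : prime p -> i \in swing u ->
  (2 * #|region i| < p)%N ->
  (rsum i (F (setc u i true)))%:~R != (rsum i (F (setc u i false)))%:~R :> 'F_p.
Proof.
move=> p_pr; rewrite inE => /andP[iS hne] rp.
set a := rsum _ _; set b := rsum _ _.
have ab : (0 < `|a - b|)%N && (`|a - b| < p)%N.
  move: hne; rewrite /hitc.
  have [ht|ht] := boolP (hit (F (setc u i true)) i);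
  have [hf|hf] := boolP (hit (F (setc u i false)) i) => //= _.
    by have := rsum_hit ht; have := rsum_nohit hf; rewrite -/a -/b => /andP[]; lia.
  by have := rsum_hit hf; have := rsum_nohit ht; rewrite -/a -/b => /andP[]; lia.
case/andP: ab => ab0 abp; rewrite -subr_eq0 -intrB.
have nz : (`|a - b|%N)%:R != 0 :> 'F_p.
  rewrite -(dvdn_pcharf (pchar_Fp p_pr)).
  by apply/negP => /dvdn_leq; lia.
apply: contraNN nz => /eqP ab0'.
by rewrite pmulrn abszE normrEsign intrM ab0' mulr0.
Qed.

End Blocks.

(** * Walks driven by a product measure *)

Section CoordinateResampling.
Variables (R : realFieldType) (I : finType) (beta : bool -> R).
Hypothesis beta_sum1 : beta true + beta false = 1.

Lemma expect_coord (i : I) (phi : {ffun I -> bool} -> R) :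
  expect (prodm beta) phi =
  expect (prodm beta) (fun u => \sum_c beta c * phi (setc u i c)).
Proof.
rewrite (expect_resample beta_sum1 [set i]); apply: eq_expect => u.
pose h c := phi (setc u i c).
transitivity (expect (prodm beta) (fun w => \prod_(j in [set i]) h (w j))).
  apply: eq_expect => w; rewrite big_set1 /h; congr phi.
  by apply/ffunP => j; rewrite !ffunE inE; case: eqP => [->|].
by rewrite (expect_prodm_prod beta_sum1 _ (fun=> h)) big_set1 big_bool.
Qed.

End CoordinateResampling.

Section Walk.
Variables (R : realFieldType) (p : nat) (I : finType) (beta : bool -> R).
Hypothesis p_pr : prime p.
Hypothesis p_odd : odd p.
Hypothesis beta_ge0 : forall c, 0 <= beta c.
Hypothesis beta_sum1 : beta true + beta false = 1.
Variables (a : I -> bool -> 'F_p) (sg : I -> bool -> bool).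

Let kappa : R := beta true * beta false.

(** The value at [c0] of [g] propagated backwards along the walk with increments [a j (w j)],
    twisted by the parities [sg j (w j)]; by [walkE_cons] it iterates [walk_step]. *)
Definition walkE (s : seq I) (g : 'F_p -> R) (c0 : 'F_p) : R :=
  expect (prodm beta) (fun w => g (c0 + \sum_(j <- s) a j (w j)) *
    \prod_(j <- s) (-1) ^+ sg j (w j)).

Lemma walkE_nil g c0 : walkE [::] g c0 = g c0.
Proof.
rewrite /walkE -[RHS](@expect_cst _ _ (@prodm R I beta)) ?prodm_sum1//.
by apply: eq_expect => w; rewrite !big_nil addr0 mulr1.
Qed.

Lemma walkE_cons i s g c0 : i \notin s ->
  walkE (i :: s) g c0 = walk_step beta (sg i) (a i) (walkE s g) c0.
Proof.
move=> si; rewrite /walkE (expect_coord beta_sum1 i) /walk_step big_bool/=.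
rewrite -!expectZ -expectD; apply: eq_expect => u.
have E c (T : Type) (idx : T) (op : T -> T -> T) (h : I -> bool -> T) :
    \big[op/idx]_(j <- s) h j (setc u i c j) = \big[op/idx]_(j <- s) h j (u j).
  apply: eq_big_seq => j js; rewrite ffunE; case: eqP => // ji.
  by rewrite -ji js in si.
rewrite big_bool/= !big_cons !(E _ _ _ _ a) !(E _ _ _ _ (fun j c => (-1) ^+ sg j c)).
by rewrite !ffunE !eqxx !addrA !mulrA; congr (_ + _); congr (_ * _); rewrite mulrAC.
Qed.

Lemma sum_walkE s g : uniq s -> \sum_t g t = 0 -> \sum_t walkE s g t = 0.
Proof.
move=> + g0; elim: s => [_|i s IH /= /andP[si us]].
  by under eq_bigr do rewrite walkE_nil.
by under eq_bigr do rewrite walkE_cons//; apply: sum_walk_step; apply: IH.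
Qed.

Lemma kappa_ge0 : 0 <= kappa. Proof. exact: mulr_ge0. Qed.

Lemma kappa_le : kappa <= 1 / 4.
Proof.
have := sqr_ge0 (beta true - beta false).
have -> : beta true = 1 - beta false by rewrite -beta_sum1 addrK.
rewrite /kappa -[beta true](addrK (beta false)) beta_sum1; nra.
Qed.

Definition contraction : R := 1 - 2 * kappa / p%:R ^+ 2.

Lemma contraction_ge0 : 0 <= contraction.
Proof.
rewrite subr_ge0 ler_pdivrMr ?exprn_gt0 ?ltr0n ?prime_gt0// mul1r.
have : 1 <= (p%:R ^+ 2 : R) by rewrite exprn_ege1// ler1n prime_gt0.
have := kappa_le; lra.
Qed.

Lemma normsq_walkE s g : uniq s -> \sum_t g t = 0 ->
  normsq (walkE s g) <=
  contraction ^+ count (fun i => a i true != a i false) s * normsq g.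
Proof.
move=> + g0; elim: s => [_|i s IH us].
  by rewrite expr0 mul1r; apply: ler_sum => t _; rewrite walkE_nil.
have /andP[si us'] := us.
have -> : normsq (walkE (i :: s) g) = normsq (walk_step beta (sg i) (a i) (walkE s g)).
  by apply: eq_bigr => t _; rewrite walkE_cons.
rewrite /=; case: (boolP (_ != _)) => [na|_].
  rewrite exprS -mulrA.
  apply: le_trans (walk_step_contract _ _ _ _ _ _ _) _ => //.
  - exact: kappa_ge0.
  - exact: sum_walkE.
  by rewrite ler_wpM2l ?contraction_ge0// IH.
rewrite add0n; apply: le_trans (IH us').
by apply: walk_step_le => //; apply: kappa_ge0.
Qed.

(** Split [g] into its mean and a mean-zero part. The mean has absolute value at most [1 / p]; the
    other part is bounded at [c0] by its norm, which contracts at every step with two distinct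
    increments. *)
Lemma walkE_bias s g c0 (e : R) : uniq s ->
  (forall t, `|g t| <= 1) -> `|\sum_t g t| <= 1 -> 0 <= e ->
  contraction ^+ count (fun i => a i true != a i false) s * p%:R <= e ^+ 2 ->
  `|walkE s g c0| <= p%:R^-1 + e.
Proof.
move=> us g1 sg1 e0 He.
have p0 : 0 < (p%:R : R) by rewrite ltr0n prime_gt0.
pose m := (\sum_t g t) / p%:R; pose g' t := g t - m.
have g'0 : \sum_t g' t = 0.
  by rewrite sumrB sumr_cstl card_Fp// /m mulrCA divff ?mulr1 ?subrr// gt_eqF.
have -> : walkE s g c0 = walkE s (fun=> m) c0 + walkE s g' c0.
  by rewrite /walkE -expectD; apply: eq_expect => w; rewrite /g'; ring.
apply: le_trans (ler_normD _ _) _; apply: lerD.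
  apply: le_trans (ler_norm_sum _ _ _) _.
  apply: (@le_trans _ _ (expect (@prodm R I beta) (fun=> p%:R^-1))); last first.
    by rewrite expect_cst ?prodm_sum1.
  apply: ler_sum => w _; rewrite normrM ger0_norm ?prodm_ge0//.
  rewrite ler_wpM2l ?prodm_ge0// normrM normr_prod.
  rewrite [X in _ * X]big1 ?mulr1; last by move=> j _; rewrite normr_sign.
  by rewrite /m normrM normfV (gtr0_norm p0) ler_piMl ?invr_ge0// ltW.
rewrite -(ger0_norm e0) -ler_sqr ?nnegrE// !real_normK ?num_real//.
apply: (@le_trans _ _ (normsq (walkE s g'))).
  rewrite /normsq (bigD1 c0)//= lerDl; apply: sumr_ge0 => t _; exact: sqr_ge0.
apply: le_trans (normsq_walkE us g'0) _; apply: le_trans He.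
rewrite ler_wpM2l ?exprn_ge0 ?contraction_ge0//.
(* Subtracting the mean lowers the norm, and [normsq g <= p] since [|g| <= 1]. *)
have -> : normsq g' = normsq g - p%:R * m ^+ 2.
  transitivity (\sum_t (g t ^+ 2 + (- (2 * m)) * g t + m ^+ 2)).
    by apply: eq_bigr => t _; rewrite /g'; ring.
  rewrite !big_split/= -mulr_sumr sumr_cstl card_Fp// -/(normsq g).
  have -> : \sum_t g t = p%:R * m by rewrite /m mulrCA divff ?mulr1// gt_eqF.
  ring.
rewrite lerBlDr; apply: le_trans (_ : p%:R <= _); last by rewrite lerDl mulr_ge0 ?sqr_ge0// ltW.
have -> : p%:R = \sum_(t : 'F_p) 1 :> R by rewrite sumr_cstl card_Fp// mulr1.
apply: ler_sum => t _.
by rewrite -real_normK ?num_real// expr_le1.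
Qed.

End Walk.

Section MajMod.
Variables (R : realFieldType) (p : nat).
Hypothesis p_pr : prime p.

Definition MMF (t : 'F_p) : bool := (p.-1./2 < (t : nat))%N.

Lemma MM_MMF (a : int) : MM p a = MMF a%:~R.
Proof.
have p0 : p%:Z != 0 by case: (p) p_pr.
have r0 := modz_ge0 a p0.
have rp : (a %% p%:Z)%Z < p%:Z.
  by have := ltz_mod a p0; rewrite ger0_norm.
rewrite /MM /MMF.
have -> : (a%:~R : 'F_p) = (a %% p%:Z)%Z%:~R.
  rewrite {1}(divz_eq a p%:Z) intrD intrM.
  by rewrite -[p%:Z%:~R]/(p%:R : 'F_p) pchar_Fp_0// mulr0 add0r.
case: (a %% p%:Z)%Z r0 rp => // m _ mp.
by rewrite -[(Posz m)%:~R]/(m%:R : 'F_p) val_Fp_nat// modn_small.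
Qed.

(** There are [(p + 1) / 2] residues of sign [1] and [(p - 1) / 2] of sign [-1]. Thus the mean is
    only [1 / p], as [walkE_bias] requires. *)
Lemma sum_MMF : odd p -> \sum_(t : 'F_p) (-1) ^+ MMF t = 1 :> R.
Proof.
move=> p_odd; rewrite -(sum_line p_pr _ 0 (oner_neq0 _)).
set h := p.-1./2.
have pE : p = (h.+1 + h)%N by have := prime_gt0 p_pr; rewrite /h; lia.
transitivity (\sum_(j < p) (-1) ^+ (h < j)%N : R).
  apply: eq_bigr => j _.
  by rewrite add0r mulr1 /MMF val_Fp_nat// modn_small.
rewrite -(big_mkord xpredT (fun j => (-1) ^+ (h < j)%N : R)) [in LHS]pE.
rewrite (@big_cat_nat _ _ _ h.+1)//= ?leq_addr//.
rewrite (eq_big_nat _ _ (F2 := fun=> 1)); last first.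
  by move=> j /andP[_]; rewrite ltnS leqNgt => /negbTE->.
rewrite [X in _ + X](eq_big_nat _ _ (F2 := fun=> -1)); last first.
  by move=> j /andP[-> _].
by rewrite !sumr_const_nat subn0 addKn mulNrn -addrC -[h.+1]addn1 mulrnDr addKr.
Qed.

End MajMod.

(** * The target distribution *)

Section Distance.
Variables (R : realType) (T : finType).

(** The excess of [P] on [A] equals the excess of [Q] on the complement, and each is at most the
    corresponding part of the sum in [tvd]; the factor [1 / 2] averages the two. *)
Lemma tvd_ge_event (P Q : T -> R) (A : {set T}) :
  \sum_y P y = 1 -> \sum_y Q y = 1 ->
  \sum_(y in A) P y - \sum_(y in A) Q y <= tvd P Q.
Proof.
move=> P1 Q1; rewrite /tvd.
set D := \sum_(y in A) P y - _.
have CE (f : T -> R) : \sum_(y in ~: A) f y = \sum_(y | y \notin A) f y.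
  by apply: eq_bigl => y; rewrite inE.
have HA : D <= \sum_(y in A) `|P y - Q y|.
  rewrite /D -sumrB; apply: le_trans (ler_norm _) _; exact: ler_norm_sum.
have HC : D <= \sum_(y in ~: A) `|P y - Q y|.
  have -> : D = \sum_(y in ~: A) (Q y - P y).
    move: P1 Q1; rewrite (bigID (mem A))/= => P1; rewrite (bigID (mem A))/= => Q1.
    by rewrite sumrB /D !CE; lra.
  apply: le_trans (ler_norm _) _; apply: le_trans (ler_norm_sum _ _ _) _.
  by apply: ler_sum => y _; rewrite distrC.
by rewrite (bigID (mem A))/= -CE; move: HA HC; lra.
Qed.

End Distance.

Section Target.
Variables (R : realType) (n p : nat).
Local Notation N := (2 * n - 2)%N.

Definition half : bool -> R := fun=> 1 / 2.

Lemma half_ge0 c : 0 <= half c. Proof. by rewrite /half; lra. Qed.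

Lemma half_sum1 : half true + half false = 1. Proof. by rewrite /half; lra. Qed.

Lemma prodm_half (I : finType) (z : {ffun I -> bool}) : prodm half z = (1 / 2) ^+ #|I|.
Proof. by rewrite /prodm prodr_const. Qed.

Definition target_of (z : {ffun 'I_N -> bool}) : N.+1.-tuple bool :=
  [tuple of rcons (mktuple z) (pmmajmod p n (mktuple z))].

Lemma nth_mktuple_lt (z : {ffun 'I_N -> bool}) (i : 'I_N) :
  nth false (mktuple z) i = z i.
Proof. by rewrite (nth_mktuple z false i). Qed.

Lemma val_target_of z :
  target_of z = rcons (mktuple z) (pmmajmod p n (mktuple z)) :> seq bool.
Proof. by []. Qed.

Lemma nth_target_of z j : (j < N)%N -> nth false (target_of z) j = nth false (mktuple z) j.
Proof. by move=> jN; rewrite val_target_of nth_rcons size_tuple jN. Qed.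

(** The only candidate for a preimage of [y] is its prefix of length [N]. *)
Lemma target_ofE (y : N.+1.-tuple bool) :
  target p n y = \sum_(z | target_of z == y) prodm half z :> R.
Proof.
pose z0 : {ffun 'I_N -> bool} := [ffun i : 'I_N => nth false y i].
have szy : size y = N.+1 by rewrite size_tuple.
have z0E : mktuple z0 = take N y :> seq bool.
  apply: (@eq_from_nth _ false).
    by rewrite size_tuple size_take szy ltnSn.
  move=> j; rewrite size_tuple => jN.
  by rewrite -[j]/(nat_of_ord (Ordinal jN)) nth_mktuple_lt ffunE nth_take.
rewrite /target; case: ifP => [/eqP yN|yN].
  rewrite (big_pred1 z0) ?prodm_half ?card_ord ?expr_div_n ?expr1n ?div1r// => z.
  apply/eqP/eqP => [zy|->].
    by apply/ffunP => i; rewrite ffunE -zy nth_target_of// nth_mktuple_lt.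
  apply: val_inj; rewrite [val _]val_target_of z0E -yN.
  rewrite -[RHS](cat_take_drop N y) -cats1; congr cat.
  by rewrite (drop_nth false) ?szy// drop_oversize ?szy.
rewrite big_pred0// => z; apply/negP => /eqP zy; move: yN; rewrite -zy val_target_of.
by rewrite nth_rcons size_tuple ltnn eqxx -cats1 take_size_cat ?size_tuple ?eqxx.
Qed.

Lemma sum_target (phi : N.+1.-tuple bool -> R) :
  \sum_y target p n y * phi y = expect (prodm half) (fun z => phi (target_of z)).
Proof.
rewrite /expect (partition_big target_of xpredT)//=.
apply: eq_bigr => y _; rewrite target_ofE mulr_suml.
by apply: eq_bigr => z /eqP->.
Qed.

Lemma target_sum1 : \sum_y target p n y = 1 :> R.
Proof.
rewrite -[RHS](prodm_sum1 'I_N half_sum1).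
have := sum_target (fun=> 1); rewrite /expect.
by under eq_bigr do rewrite mulr1; move=> ->; apply: eq_bigr => z _; rewrite mulr1.
Qed.

Lemma target_le (y : N.+1.-tuple bool) : target p n y <= (2 ^+ N)^-1 :> R.
Proof. by rewrite /target; case: ifP => // _; rewrite invr_ge0 exprn_ge0. Qed.

Lemma target_ge0 (y : N.+1.-tuple bool) : 0 <= target p n y :> R.
Proof. by rewrite /target; case: ifP => // _; rewrite invr_ge0 exprn_ge0. Qed.

(* [d |-> h(d)] is a bijection, so the [h(d)_i] are uniform independent bits. *)
Definition unpath (z : {ffun 'I_N -> bool}) : {ffun 'I_N -> bool} :=
  [ffun j : 'I_N => if (j < n.-1)%N then hb (mktuple z) j.+1 else z j].

Lemma unpath_inj : injective unpath.
Proof.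
move=> z1 z2 z12.
have hE w : (w < n)%N -> hb (mktuple z1) w = hb (mktuple z2) w.
  case: w => // w wn; have wN : (w < N)%N by lia.
  have /ffunP/(_ (Ordinal wN)) := z12; rewrite !ffunE /=.
  by have -> : (w < n.-1)%N by lia.
apply/ffunP => j; have /ffunP/(_ j) := z12; rewrite !ffunE; case: ifP => // jn _.
have dE (z : {ffun 'I_N -> bool}) : z j = hb (mktuple z) j.+1 (+) hb (mktuple z) (j./2).
  by rewrite /hb htree_parent//= -addbA addbb addbF nth_mktuple_lt.
by rewrite !dE !hE//; lia.
Qed.

Lemma expect_unpath (phi : {ffun 'I_N -> bool} -> R) :
  expect (prodm half) (fun z => phi (unpath z)) = expect (prodm half) phi.
Proof.
rewrite /expect [RHS](reindex_inj unpath_inj)/=.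
by apply: eq_bigr => z _; rewrite !prodm_half.
Qed.

Variables (I : finType) (r : nat) (dep : nat -> {set I}) (S : {set I}).
Local Notation region := (region n r dep).
Local Notation hit := (hit n r dep).
Hypothesis S_disj : forall i j, i \in S -> j \in S -> i != j ->
  [disjoint region i & region j].

(** The vertex that coordinate [j] belongs to: the first [n.-1] coordinates are edge bits ([h] bits
    after [unpath]), the others are [x] bits. *)
Definition node (j : nat) : nat := if (j < n.-1)%N then j.+1 else (j - n.-1).+1.

Definition hit_coords (i : I) : {set 'I_N} :=
  [set j : 'I_N | [exists w in region i, (w : nat) == node j]].

Lemma card_hit_coords i : (#|hit_coords i| <= 2 * #|region i|)%N.
Proof.
pose enc (j : 'I_N) : option 'I_n * bool := (insub (node j), (j < n.-1)%N).
have enc_inj : {in hit_coords i &, injective enc}.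
  move=> j k; rewrite !inE => /exists_inP[v _ /eqP vj] /exists_inP[w _ /eqP wk].
  rewrite /enc -vj -wk !valK => -[vw jk]; apply: val_inj => /=.
  by move: vj wk; rewrite vw /node -jk; case: ifP; lia.
rewrite -(card_in_imset enc_inj).
have -> : (2 * #|region i| = #|setX [set Some w | w in region i] [set: bool]|)%N.
  by rewrite cardsX cardsT card_bool (card_imset _ Some_inj) mulnC.
apply: subset_leq_card; apply/fintype.subsetP => _ /imsetP[j + ->].
rewrite inE => /exists_inP[v vi /eqP vj].
by rewrite /enc -vj valK !inE andbT; apply/imsetP; exists v.
Qed.

Lemma disjoint_hit_coords i j : i \in S -> j \in S -> i != j ->
  [disjoint hit_coords i & hit_coords j].
Proof.
move=> iS jS ij; rewrite disjoint_subset; apply/fintype.subsetP => k.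
rewrite !inE => /exists_inP[v vi /eqP vk]; apply/negP => /exists_inP[w wj /eqP wk].
have vw : v = w by apply: val_inj; rewrite /= vk wk.
by have /disjointFr/(_ vi) := S_disj iS jS ij; rewrite vw wj.
Qed.

(** After [unpath] a hit prescribes its coordinates one by one: false for an [h] bit and true for an
    [x] bit, which is the value of [n.-1 <= j]. *)
Definition hit_ind (i : I) (v : {ffun 'I_N -> bool}) : R :=
  \prod_(j in hit_coords i) (v j == (n.-1 <= j)%N)%:R.

Lemma hit_target_of z i : (hit (target_of z) i)%:R = hit_ind i (unpath z).
Proof.
have xE (w : 'I_n) : (0 < w)%N -> xb n (target_of z) w = nth false (mktuple z) (n.-1 + w.-1).
  by move=> w0; rewrite /xb nth_target_of//; have := ltn_ord w; lia.
have hE w : (w < n)%N -> hb (target_of z) w = hb (mktuple z) w.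
  elim/ltn_ind: w => -[//|w] IH wn; rewrite /hb.
  rewrite (htree_parent (fun j => nth false (target_of z) j.-1))//.
  rewrite (htree_parent (fun j => nth false (mktuple z) j.-1))//.
  congr (_ (+) _); first by apply: nth_target_of; lia.
  by apply: IH => /=; lia.
rewrite /hit_ind; case: (boolP (hit _ _)) => [/forall_inP H|].
  rewrite big1// => j; rewrite inE => /exists_inP[w wi /eqP wj].
  have /andP[] := H w wi; rewrite xE ?(region_gt0 wi)// hE// => xw hw.
  rewrite ffunE; move: wj; rewrite /node; case: ifP => jn wj.
    by rewrite -wj (negbTE hw) leqNgt jn.
  move: xw; rewrite wj /= subnKC; last by rewrite leqNgt jn.
  by rewrite nth_mktuple_lt leqNgt jn => ->.
rewrite negb_forall_in => /exists_inP[w wi]; have w0 := region_gt0 wi.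
rewrite xE// hE// => nw; have wn := ltn_ord w.
(* The violation at [w] is [h = 1] or [x = 0]; the factor of the corresponding coordinate
   vanishes. *)
have [h1|h0] := boolP (hb (mktuple z) w).
  have jN : (w.-1 < N)%N by lia.
  rewrite (bigD1 (Ordinal jN))/=; last first.
    by rewrite inE; apply/exists_inP; exists w => //; rewrite /node /= ifT; lia.
  rewrite ffunE /= ifT; last by lia.
  have jf : (n.-1 <= w.-1)%N = false by lia.
  by rewrite prednK// h1 jf mul0r.
have jN : (n.-1 + w.-1 < N)%N by lia.
rewrite (bigD1 (Ordinal jN))/=; last first.
  rewrite inE; apply/exists_inP; exists w => //; rewrite /node /= ifF; lia.
rewrite ffunE /= ifF; last by lia.
move: nw; rewrite h0 andbT -[(_ + _)%N]/(nat_of_ord (Ordinal jN)) nth_mktuple_lt.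
by move=> /negbTE->; rewrite /= leq_addr mul0r.
Qed.

Lemma expect_all_hit (A : {set 'I_N}) :
  expect (prodm half) (fun v : {ffun 'I_N -> bool} =>
    \prod_(j in A) (v j == (n.-1 <= j)%N)%:R) = (1 / 2) ^+ #|A|.
Proof.
pose c (j : 'I_N) b : R := (b == (n.-1 <= j)%N)%:R.
rewrite -[LHS]/(expect (prodm half) (fun v => \prod_(j in A) c j (v j))).
rewrite (expect_prodm_prod half_sum1 A c) -prodr_const; apply: eq_bigr => j _.
by rewrite /half /c; case: (_ <= _)%N => /=; lra.
Qed.

Lemma expect_hit_ind i : expect (prodm half) (hit_ind i) = (1 / 2) ^+ #|hit_coords i|.
Proof. exact: expect_all_hit. Qed.

Lemma expect_hit_ind2 i j : i \in S -> j \in S -> i != j ->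
  expect (prodm half) (fun v => hit_ind i v * hit_ind j v) =
  expect (prodm half) (hit_ind i) * expect (prodm half) (hit_ind j).
Proof.
move=> iS jS ij; have dij := disjoint_hit_coords iS jS ij.
rewrite !expect_hit_ind -exprD.
have -> : (#|hit_coords i| + #|hit_coords j| = #|hit_coords i :|: hit_coords j|)%N.
  by rewrite cardsU; move: dij; rewrite -setI_eq0 => /eqP->; rewrite cards0 subn0.
rewrite -expect_all_hit; apply: eq_expect => v; rewrite /hit_ind -bigU//.
by apply: eq_bigl => k; rewrite !inE.
Qed.

(** The mean number [mu] of hits is at least [m]. Hits are indicators, so their second moments also
    add up to [mu], and Chebyshev at distance [mu / 2] gives [4 / mu]. *)
Lemma target_few_hits (B : nat) (m : R) : 0 < m ->
  (forall i, i \in S -> (#|region i| <= B)%N) ->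
  m <= #|S|%:R * (1 / 2) ^+ (2 * B) ->
  \sum_(y : N.+1.-tuple bool | #|[set i in S | hit y i]|%:R <= m / 2) target p n y <= 4 / m.
Proof.
move=> m0 HB Hm.
pose cnt (v : {ffun 'I_N -> bool}) := \sum_(i in S) hit_ind i v.
pose mu := \sum_(i in S) expect (prodm half) (hit_ind i).
have mmu : m <= mu.
  apply: le_trans Hm _; rewrite -sumr_cstl; apply: ler_sum => i iS.
  rewrite expect_hit_ind; apply: ler_wiXn2l; rewrite ?divr_ge0//; first by lra.
  by apply: leq_trans (card_hit_coords i) _; rewrite leq_mul2l HB.
have mu0 : 0 < mu by apply: lt_le_trans mmu.
have cntE z : #|[set i in S | hit (target_of z) i]|%:R = cnt (unpath z).
  rewrite /cnt -sum1_card natr_sum.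
  under eq_bigl do rewrite inE.
  rewrite big_mkcondr; apply: eq_bigr => i _; rewrite -hit_target_of.
  by case: (hit _ _).
have -> : \sum_(y : N.+1.-tuple bool | #|[set i in S | hit y i]|%:R <= m / 2) target p n y =
    expect (prodm half) (fun v => (cnt v <= m / 2)%R%:R).
  rewrite -expect_unpath big_mkcond.
  rewrite -(eq_expect _ (Y := fun z => (#|[set i in S | hit (target_of z) i]|%:R <= m / 2)%R%:R)).
    rewrite -(sum_target (fun y : N.+1.-tuple bool => (#|[set i in S | hit y i]|%:R <= m / 2)%R%:R)).
    by apply: eq_bigr => y _; case: ifP; rewrite ?mulr1 ?mulr0.
  by move=> z; rewrite cntE.
have half_mu0 : 0 < mu / 2 by lra.
have cheb := chebyshev_sum (prodm_ge0 half_ge0) (prodm_sum1 'I_N half_sum1) half_mu0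
  expect_hit_ind2.
apply: le_trans (le_trans _ cheb) _.
  rewrite /expect [leRHS]big_mkcond; apply: ler_sum => v _.
  case: (boolP (cnt v <= m / 2)) => [cv|_]; last first.
    by rewrite mulr0; case: ifP => // _; apply: prodm_ge0; apply: half_ge0.
  rewrite mulr1 ifT// -/(cnt v) -/mu ler0_norm; lra.
have -> : \sum_(i in S) expect (prodm half) (fun w => hit_ind i w ^+ 2) = mu.
  apply: eq_bigr => i _; apply: eq_expect => v; rewrite /hit_ind -prodrXl.
  by apply: eq_bigr => j _; case: (_ == _); rewrite ?expr1n ?expr0n.
have -> : mu / (mu / 2) ^+ 2 = 4 / mu by field; rewrite gt_eqF.
by rewrite ler_pM2l// lef_pV2 ?posrE.
Qed.

End Target.

(** * Choosing inputs with disjoint regions *)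

Lemma sqr_lt_exp2 B : (6 <= B)%N -> (4 + B * B <= 2 ^ B)%N.
Proof.
elim: B => // B IH; rewrite leq_eqVlt => /predU1P[<-//|]; rewrite ltnS => B6.
by have := IH B6; rewrite expnS; nia.
Qed.

Section Selection.
Variables (I : finType) (n dn : nat) (dep : nat -> {set I}).
Hypothesis dn_gt0 : (0 < dn)%N.
Hypothesis card_dep : forall j, (#|dep j| <= dn)%N.
Hypothesis n_large : (4 * dn + 4 <= n)%N.

Local Notation depv := (depv n dep).

(** This makes [2 ^ r] lie between [8 * dn] and [16 * dn]. An input that is not crowded touches at
    most [8 * dn] vertices, so its region has at most [8 * dn * 16 * dn = B] of them. *)
Let r := up_log 2 (8 * dn).
Let B := (128 * dn ^ 2)%N.

Lemma height_gt0 : (0 < r)%N.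
Proof. by rewrite /r up_log_gt0; lia. Qed.

Lemma height_lb : (8 * dn <= 2 ^ r)%N.
Proof. by rewrite up_logP. Qed.

Lemma height_ub : (2 ^ r < 16 * dn)%N.
Proof.
have /andP[] : (2 ^ r.-1 < 8 * dn <= 2 ^ r)%N by apply: up_log_bounds; lia.
by case: (r) height_gt0 => // k _; rewrite expnS/=; lia.
Qed.

Lemma card_depv w : (#|depv w| <= 2 * dn)%N.
Proof.
apply: leq_trans (leq_card_setU _ _) _.
by rewrite mul2n -addnn leq_add.
Qed.

Definition touched (i : I) : {set 'I_n} := [set v : 'I_n | (0 < v)%N && (i \in depv v)].

(** Double counting: each of the [n.-1] non-root vertices reads at most [2 * dn] inputs. *)
Lemma sum_touched : (\sum_i #|touched i| <= 2 * dn * n.-1)%N.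
Proof.
apply: (@leq_trans (\sum_(v : 'I_n | (0 < v)%N) #|depv v|)%N).
  under eq_bigr => i _ do rewrite -sum1_card big_mkcond/=.
  rewrite exchange_big/= [leqRHS]big_mkcond; apply: leq_sum => v _.
  case: (posnP v) => [v0|v0].
    by rewrite big1// => i _; rewrite inE v0.
  rewrite -sum1_card [leqRHS]big_mkcond; apply: leq_sum => i _.
  by rewrite inE v0.
apply: (@leq_trans (\sum_(v : 'I_n | (0 < v)%N) 2 * dn)).
  by apply: leq_sum => v _; apply: card_depv.
rewrite sum_nat_const mulnC leq_mul2l; apply/orP; right.
have n0 : (0 < n)%N by lia.
rewrite -ltnS prednK// -[ltnRHS]card_ord; apply: proper_card.
by apply/fintype.properP; split; [apply/fintype.subsetP|exists (Ordinal n0)].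
Qed.

Definition crowded : {set I} := [set i | (8 * dn < #|touched i|)%N].

Lemma card_crowded : (4 * #|crowded| <= n.-1)%N.
Proof.
have : (8 * dn * #|crowded| <= 2 * dn * n.-1)%N.
  apply: leq_trans sum_touched; rewrite mulnC -sum_nat_const big_mkcond.
  by apply: leq_sum => i _; rewrite inE; case: ifP => // /ltnW.
nia.
Qed.

Definition high : {set I} :=
  \bigcup_(v : 'I_n | (0 < v)%N && (2 ^ r * v.+1 <= n)%N) depv v.

(** At most [n / 2 ^ r <= n / (8 * dn)] vertices are high, and each reads at most [2 * dn]
    inputs. *)
Lemma card_high : (4 * #|high| <= n)%N.
Proof.
pose m := (n %/ 2 ^ r)%N.
have mE v : (2 ^ r * v.+1 <= n)%N = (v < m)%N.
  by rewrite /m leq_divRL ?expn_gt0// mulnC.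
have c1 : (#|high| <= \sum_(v : 'I_n | (0 < v)%N && (2 ^ r * v.+1 <= n)%N) 2 * dn)%N.
  rewrite /high; elim/big_rec2: _ => [|v k A _ IH]; first by rewrite cards0.
  apply: leq_trans (leq_card_setU _ _) _; exact: leq_add (card_depv _) IH.
have c2 : (\sum_(v : 'I_n | (0 < v)%N && (2 ^ r * v.+1 <= n)%N) 2 * dn <= m * (2 * dn))%N.
  rewrite sum_nat_const leq_mul2r; apply/orP; right.
  have mn : (m <= n)%N by apply: leq_div.
  rewrite -[m in leqRHS]card_ord.
  have winj : injective (widen_ord mn) by move=> a b [] ab; apply: val_inj.
  rewrite -(card_imset _ winj).
  apply: subset_leq_card; apply/fintype.subsetP => v.
  rewrite !unfold_in mE => /andP[_ vm]; apply/imsetP; exists (Ordinal vm) => //.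
  exact: val_inj.
have c3 : (m * (8 * dn) <= n)%N.
  by apply: leq_trans (leq_trunc_div n (2 ^ r)); rewrite leq_mul2l height_lb orbT.
nia.
Qed.

(** The descendants of a vertex at depth [j] number at most [2 ^ j], told apart by their shifted
    index modulo [2 ^ j]; sum over [j < r] and over the touched vertices. *)
Lemma card_region i : i \notin crowded -> (#|region n r dep i| <= B)%N.
Proof.
rewrite inE -leqNgt => ti.
have sub : region n r dep i \subset
    \bigcup_(v in touched i) \bigcup_(j < r) [set w : 'I_n | (w.+1 %/ 2 ^ j)%N == v.+1].
  apply/fintype.subsetP => w; rewrite inE => /andP[_ /existsP[j /existsP[v /and3P[v0 iv wv]]]].
  apply/bigcupP; exists v; first by rewrite inE v0.
  by apply/bigcupP; exists j => //; rewrite inE.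
apply: leq_trans (subset_leq_card sub) _.
have block (v j : nat) : (#|[set w : 'I_n | (w.+1 %/ 2 ^ j)%N == v]| <= 2 ^ j)%N.
  pose e (w : 'I_n) : 'I_(2 ^ j) := Ordinal (ltn_pmod w.+1 (expn_gt0 2 j)).
  rewrite -[leqRHS]card_ord.
  have einj : {in [set w : 'I_n | (w.+1 %/ 2 ^ j)%N == v] &, injective e}.
    move=> w1 w2; rewrite !inE => /eqP e1 /eqP e2 [] e12; apply: val_inj.
    apply: succn_inj; rewrite (divn_eq w1.+1 (2 ^ j)) (divn_eq w2.+1 (2 ^ j)).
    by rewrite e1 e2 e12.
  by rewrite -(card_in_imset einj); apply: max_card.
have block_r (v : nat) : (#|\bigcup_(j < r) [set w : 'I_n | (w.+1 %/ 2 ^ j)%N == v]| <= 2 ^ r)%N.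
  apply: (@leq_trans (\sum_(j < r) 2 ^ j)).
    elim/big_rec2: _ => [|j k A _ IH]; first by rewrite cards0.
    apply: leq_trans (leq_card_setU _ _) _; exact: leq_add (block _ _) IH.
  have : (\sum_(j < r) 2 ^ j).+1 = (2 ^ r)%N.
    elim: (r) => [|k IH]; first by rewrite big_ord0.
    by rewrite big_ord_recr/= -addSn IH expnS; lia.
  by lia.
apply: (@leq_trans (\sum_(v in touched i) 2 ^ r)).
  elim/big_rec2: _ => [|v k A _ IH]; first by rewrite cards0.
  apply: leq_trans (leq_card_setU _ _) _; exact: leq_add (block_r _) IH.
rewrite sum_nat_const /B; have := height_ub; nia.
Qed.

Lemma card_region_inputs (w : 'I_n) :
  (#|[set i | w \in region n r dep i]| <= r * (2 * dn))%N.
Proof.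
have sub : [set i | w \in region n r dep i] \subset
    \bigcup_(j < r) depv (w.+1 %/ 2 ^ j).-1.
  apply/fintype.subsetP => i; rewrite !inE => /andP[_ /existsP[j /existsP[v]]].
  move=> /and3P[v0 iv /eqP wv]; apply/bigcupP; exists j => //.
  by rewrite wv.
apply: leq_trans (subset_leq_card sub) _.
apply: (@leq_trans (\sum_(j < r) 2 * dn)); last by rewrite sum_nat_const card_ord.
elim/big_rec2: _ => [|j k A _ IH]; first by rewrite cards0.
apply: leq_trans (leq_card_setU _ _) _; exact: leq_add (card_depv _) IH.
Qed.

(** Take a maximal set of good inputs with disjoint regions. Each member conflicts with at most
    [B * (r * (2 * dn))] inputs, and by maximality every good input is a member or in conflict with
    one. *)
Lemma selection (U : {set I}) : (n.-1 <= #|U|)%N ->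
  exists S : {set I}, [/\ S \subset U, (n <= #|S| * 2 ^ B)%N,
    forall i, i \in S -> low n r dep i,
    (forall i j, i \in S -> j \in S -> i != j ->
      [disjoint region n r dep i & region n r dep j]) /\
    (forall i, i \in S -> i \notin dep (2 * n - 2)) &
    forall i, i \in S -> (#|region n r dep i| <= B)%N].
Proof.
move=> cU.
pose G := U :\: (crowded :|: high :|: dep (2 * n - 2)).
(* Crowded and high inputs remove at most about [n / 4] each, and the last output bit at most
   [dn]. *)
have cG : (n <= 4 * #|G|)%N.
  have : (#|U| <= #|G| + (#|crowded| + #|high| + #|dep (2 * n - 2)%N|))%N.
    rewrite -(cardsID (crowded :|: high :|: dep (2 * n - 2)) U) addnC leq_add2l.
    apply: leq_trans (subset_leq_card (subsetIr _ _)) _.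
    apply: leq_trans (leq_card_setU _ _) _; rewrite leq_add2r.
    exact: leq_card_setU.
  by have := card_crowded; have := card_high; have := card_dep (2 * n - 2); lia.
have GP i : i \in G -> [/\ i \in U, i \notin crowded, i \notin high & i \notin dep (2 * n - 2)].
  by rewrite !in_setD !in_setU !negb_or => /andP[/andP[/andP[? ?] ?] ?].
pose ind (S : {set I}) := (S \subset G) && [forall i in S, forall j in S,
  (i != j) ==> [disjoint region n r dep i & region n r dep j]].
have ind0 : ind set0.
  by rewrite /ind sub0set; apply/forall_inP => i; rewrite inE.
have [S /maxsetP[/andP[SG /forall_inP Sdis] Smax]] := ex_maxset (ex_intro _ set0 ind0).
have disS i j : i \in S -> j \in S -> i != j ->
    [disjoint region n r dep i & region n r dep j].
  by move=> iS jS ij; have /forall_inP/(_ j jS)/implyP/(_ ij) := Sdis i iS.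
have SGP i : i \in S -> i \in G by apply: (fintype.subsetP SG).
exists S; split.
- by apply/fintype.subsetP => i /SGP/GP[].
- pose conf i := \bigcup_(w in region n r dep i) [set j | w \in region n r dep j].
  have cconf i : i \in S -> (#|conf i| <= B * (r * (2 * dn)))%N.
    move=> /SGP/GP[_ ic _ _].
    apply: (@leq_trans (\sum_(w in region n r dep i) r * (2 * dn))).
      rewrite /conf; elim/big_rec2: _ => [|w k A _ IH]; first by rewrite cards0.
      apply: leq_trans (leq_card_setU _ _) _; exact: leq_add (card_region_inputs _) IH.
    by rewrite sum_nat_const leq_mul2r card_region// orbT.
  have cover_G : G \subset S :|: \bigcup_(i in S) conf i.
    apply/fintype.subsetP => i iG; rewrite inE.
    have [//|iS /=] := boolP (i \in S).
    apply: contraT => ni.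
    have di j : j \in S -> [disjoint region n r dep i & region n r dep j].
      move=> jS; rewrite disjoint_subset; apply/fintype.subsetP => w wi.
      rewrite inE; apply: contra ni => wj.
      by apply/bigcupP; exists j => //; apply/bigcupP; exists w => //; rewrite inE.
    have indi : ind (i |: S).
      rewrite /ind finset.subUset sub1set iG SG/=.
      apply/forall_inP => j /setU1P[->|jS]; apply/forall_inP => k /setU1P[->|kS];
        apply/implyP => jk.
      + by rewrite eqxx in jk.
      + exact: di.
      + by rewrite disjoint_sym; apply: di.
      + exact: disS.
    have iSE := Smax _ indi (subsetUr _ _).
    by rewrite -iSE setU11 in iS.
  have c1 : (#|G| <= #|S| + #|S| * (B * (r * (2 * dn))))%N.
    apply: leq_trans (subset_leq_card cover_G) _.
    apply: leq_trans (leq_card_setU _ _) _; rewrite leq_add2l -sum_nat_const.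
    elim/big_rec2: _ => [|i k A iS IH]; first by rewrite cards0.
    apply: leq_trans (leq_card_setU _ _) _; exact: leq_add (cconf _ iS) IH.
  have B6 : (6 <= B)%N by rewrite /B; nia.
  have r16 : (r <= 16 * dn)%N.
    by apply: leq_trans (ltnW height_ub); rewrite ltnW// ltn_expl.
  have c2 : (4 * (r * (2 * dn)) <= B)%N by rewrite /B; nia.
  have c3 : (4 * (1 + B * (r * (2 * dn))) <= 2 ^ B)%N.
    apply: leq_trans (sqr_lt_exp2 B6).
    rewrite mulnDr muln1 leq_add2l mulnCA leq_mul2l c2 orbT//.
  apply: leq_trans cG _; rewrite -mulnS in c1.
  apply: leq_trans (leq_mul (leqnn 4) c1) _.
  by rewrite mulnCA leq_mul2l -add1n c3 orbT.
- move=> i /SGP/GP[_ _ ih _] v /andP[v0 vn] iv; rewrite ltnNge.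
  apply: contra ih => hv; apply/bigcupP; exists (Ordinal vn) => //=.
  by rewrite v0.
- split=> // i /SGP/GP[]//.
- by move=> i /SGP/GP[_ ic _ _]; apply: card_region.
Qed.

End Selection.

(** * Entropy and typical inputs *)

Section Entropy.
Variable R : realType.
Implicit Types t b : R.

Lemma ln_le_sub1 t : 0 < t -> ln t <= t - 1.
Proof.
by move=> t0; have := @le_ln1Dx R (t - 1); rewrite subrKC; apply; lra.
Qed.

Lemma oppr_ln_le t : 0 < t -> - ln t <= t^-1 - 1.
Proof. by move=> t0; rewrite -lnV ?posrE// ln_le_sub1// invr_gt0. Qed.

Lemma xlnx_le t : 0 < t -> t * - ln t <= 1 - t.
Proof.
move=> t0; have := ler_wpM2l (ltW t0) (oppr_ln_le t0).
by rewrite mulrBr mulr1 divff ?gt_eqF.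
Qed.

Lemma ln2_ge : 1 / 2 <= ln 2 :> R.
Proof.
have := @oppr_ln_le 2; have := @ln_le_sub1 (2^-1); rewrite lnV ?posrE//.
have : (2^-1 : R) = 1 / 2 by rewrite div1r.
by move=> -> H _; have := H _; lra.
Qed.

Lemma ln2_le : ln 2 <= 1 :> R.
Proof. by have := @ln_le_sub1 2; lra. Qed.

Lemma ln_sqrt t : 0 < t -> ln t = 2 * ln (Num.sqrt t).
Proof.
by move=> t0; rewrite -{1}(sqr_sqrtr (ltW t0)) lnXn ?sqrtr_gt0// mulr2n mulrDl mul1r.
Qed.

(** Apply [s * - ln s <= 1 - s] at [s = sqrt t], and use [1 - s <= sqrt (1 - t)]. *)
Lemma xlnx_bounds t : 0 < t <= 1 ->
  0 <= - (t * ln t) <= 2 * Num.sqrt (t * (1 - t)).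
Proof.
move=> /andP[t0 t1].
have ln0 : ln t <= 0 by apply: ln_le0.
rewrite -mulrN mulr_ge0 ?oppr_ge0 ?(ltW t0)//= ln_sqrt//.
set s := Num.sqrt t.
have s0 : 0 < s by rewrite sqrtr_gt0.
have st : t = s ^+ 2 by rewrite sqr_sqrtr// ltW.
have s1 : s <= 1 by rewrite -sqrtr1 ler_wsqrtr.
have H := xlnx_le s0.
rewrite sqrtrM ?(ltW t0)// -/s.
set q := Num.sqrt (1 - t).
have q0 : 0 <= q by apply: sqrtr_ge0.
have q2 : q ^+ 2 = 1 - t by rewrite sqr_sqrtr// subr_ge0.
have sq : 1 - s <= q.
  rewrite -ler_sqr ?nnegrE// ?subr_ge0// q2 st; nra.
have := ler_wpM2l (ltW s0) H; have := ler_wpM2l (ltW s0) sq.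
rewrite st; lra.
Qed.

Lemma xln2x_bound t : 0 < t <= 1 -> t * ln t ^+ 2 <= 4.
Proof.
move=> /andP[t0 t1].
rewrite ln_sqrt//; set s := Num.sqrt t.
have s0 : 0 < s by rewrite sqrtr_gt0.
have st : t = s ^+ 2 by rewrite sqr_sqrtr// ltW.
have s1 : s <= 1 by rewrite -sqrtr1 ler_wsqrtr.
have ln0 : ln s <= 0 by apply: ln_le0.
have H := xlnx_le s0.
have H0 : 0 <= s * (- ln s) by rewrite mulr_ge0 ?oppr_ge0// ltW.
have -> : t * (2 * ln s) ^+ 2 = 4 * (s * - ln s) ^+ 2 by rewrite st; ring.
have H1 : s * - ln s <= 1 by apply: le_trans H _; rewrite gerBl ltW.
have : (s * - ln s) ^+ 2 <= 1 by rewrite exprn_ile1.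
lra.
Qed.

Section Bernoulli.
Variables (b k : R).
Hypothesis b_bnd : -(1/2) <= b <= 1/2.
Hypothesis k_ge1 : 1 <= k.
Hypothesis Hb : Hbern b = k^-1.

Lemma bern_sum1 : bern b true + bern b false = 1.
Proof. by rewrite /bern; lra. Qed.

(** The entropy [1 / k] is positive, which excludes the deterministic biases [1 / 2] and
    [- (1 / 2)]. *)
Lemma bern_gt0 c : 0 < bern b c.
Proof.
have Hpos : 0 < Hbern b by rewrite Hb invr_gt0 (lt_le_trans ltr01).
case/andP: b_bnd => b1 b2.
have nb1 : b != 1 / 2.
  apply: contraTneq Hpos => b12; rewrite -leNgt /Hbern b12 subrr /xlog2x eqxx.
  have -> : 1 / 2 + 1 / 2 = 1 :> R by lra.
  by rewrite oner_eq0 ln1 mul0r mulr0 addr0 oppr0.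
have nb2 : b != - (1 / 2).
  apply: contraTneq Hpos => b12; rewrite -leNgt /Hbern b12 subrr opprK /xlog2x eqxx.
  have -> : 1 / 2 + 1 / 2 = 1 :> R by lra.
  by rewrite oner_eq0 ln1 mul0r mulr0 addr0 oppr0.
have : b < 1 / 2 by rewrite lt_neqAle nb1.
have : - (1 / 2) < b by rewrite lt_neqAle eq_sym nb2.
by rewrite /bern; case: c; lra.
Qed.

Lemma bern_ge0 c : 0 <= bern b c. Proof. exact/ltW/bern_gt0. Qed.

Lemma bern_compl c : 1 - bern b c = bern b (~~ c).
Proof. by rewrite /bern; case: c => /=; lra. Qed.

Lemma bern_le1 c : bern b c <= 1.
Proof. by have := bern_compl c; have := bern_ge0 (~~ c); lra. Qed.

(** The variance of one input bit. It governs the contraction of the walk and bounds from below the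
    information carried by a frozen input. *)
Definition kap : R := bern b true * bern b false.

Lemma kap_gt0 : 0 < kap. Proof. by rewrite mulr_gt0 ?bern_gt0. Qed.

Lemma kap_le1 : kap <= 1.
Proof. by rewrite mulr_ile1 ?bern_ge0 ?bern_le1. Qed.

Lemma kap_bern c : kap <= - ln (bern b c).
Proof.
have h1 : bern b (~~ c) <= - ln (bern b c).
  by have := ln_le_sub1 (bern_gt0 c); have := bern_compl c; lra.
have hT : kap <= bern b true by rewrite /kap ler_piMr ?bern_ge0 ?bern_le1.
have hF : kap <= bern b false by rewrite /kap ler_piMl ?bern_ge0 ?bern_le1.
by apply: le_trans h1; case: (c); [exact: hF|exact: hT].
Qed.

Lemma bern_entropy :
  - (bern b true * ln (bern b true)) - bern b false * ln (bern b false) = ln 2 / k.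
Proof.
have l2 : (ln 2 : R) != 0 by rewrite gt_eqF//; have := ln2_ge; lra.
have xE t : 0 < t -> xlog2x t * ln 2 = t * ln t.
  by move=> t0; rewrite /xlog2x gt_eqF// mulrA -mulrA mulVf ?mulr1.
have := bern_gt0 true; have := bern_gt0 false; rewrite /bern => f0 t0.
by rewrite [RHS]mulrC -Hb /Hbern mulNr [in RHS]mulrDl !xE//; ring.
Qed.

(** By [xlnx_bounds] the entropy [ln 2 / k] in nats is at most [4 * sqrt kap]; square this, using
    [ln 2 >= 1 / 2]. *)
Lemma kap_ge : 1 / (64 * k ^+ 2) <= kap.
Proof.
have k0 : 0 < k by rewrite (lt_le_trans ltr01).
have bT : 0 < bern b true <= 1 by rewrite bern_gt0 bern_le1.
have bF : 0 < bern b false <= 1 by rewrite bern_gt0 bern_le1.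
have /andP[_ hT] := xlnx_bounds bT; have /andP[_ hF] := xlnx_bounds bF.
rewrite bern_compl -[~~ true]/false -/kap in hT.
rewrite bern_compl -[~~ false]/true [bern b false * bern b true]mulrC -/kap in hF.
set q := Num.sqrt kap in hT hF.
have q0 : 0 <= q by apply: sqrtr_ge0.
have q2 : q ^+ 2 = kap by rewrite sqr_sqrtr// ltW ?kap_gt0.
have h : ln 2 / k <= 4 * q by rewrite -bern_entropy; lra.
have hk : 1 / (2 * k) <= 4 * q.
  have -> : 1 / (2 * k) = (1 / 2) / k by field; rewrite gt_eqF.
  by apply: le_trans h; rewrite ler_pM2r ?invr_gt0// ln2_ge.
have -> : 1 / (64 * k ^+ 2) = (1 / (2 * k)) ^+ 2 / 16 by field; rewrite gt_eqF.
have : (1 / (2 * k)) ^+ 2 <= (4 * q) ^+ 2.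
  have k1 : 0 <= 1 / (2 * k) by apply: divr_ge0 => //; apply: mulr_ge0 => //; apply: ltW.
  by rewrite ler_sqr// nnegrE mulr_ge0.
rewrite -q2; lra.
Qed.

(** The bound is uniform in the bias, so Chebyshev does not degrade for large [k]. *)
Lemma bern_ln2_moment :
  bern b true * ln (bern b true) ^+ 2 + bern b false * ln (bern b false) ^+ 2 <= 8.
Proof.
have := @xln2x_bound (bern b true); have := @xln2x_bound (bern b false).
by rewrite !bern_gt0 !bern_le1 => /(_ isT) h1 /(_ isT) h2; lra.
Qed.

Variable I : finType.
Local Notation ffb := {ffun I -> bool}.
Local Notation Pm := (@prodm R I (bern b)).

Lemma expect_one (h : bool -> R) (i : I) :
  expect Pm (fun u => h (u i)) = bern b true * h true + bern b false * h false.
Proof.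
rewrite (expect_coord bern_sum1 i).
rewrite -[RHS](@expect_cst _ _ Pm) ?prodm_sum1 ?bern_sum1//; apply: eq_expect => u.
by rewrite big_bool !ffunE !eqxx.
Qed.

Lemma expect_two (h : bool -> R) (i j : I) : i != j ->
  expect Pm (fun u => h (u i) * h (u j)) =
  expect Pm (fun u => h (u i)) * expect Pm (fun u => h (u j)).
Proof.
move=> ij; rewrite (expect_coord bern_sum1 i) expect_one -expectZ.
apply: eq_expect => u; rewrite big_bool/= !ffunE !eqxx.
by rewrite [j == i]eq_sym (negbTE ij); ring.
Qed.

(** The information content in nats: minus the logarithm of the probability of the coordinates of
    [u] in [U]. *)
Definition loglik (U : {set I}) (u : ffb) : R := \sum_(i in U) - ln (bern b (u i)).

Lemma typical_prob (U : {set I}) (t : R) : 0 < t ->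
  \sum_(u | #|U|%:R * (ln 2 / k) + t <= loglik U u) Pm u <= 8 * #|U|%:R / t ^+ 2.
Proof.
move=> t0.
have cheb := @chebyshev_sum R _ Pm (prodm_ge0 bern_ge0) (prodm_sum1 I bern_sum1)
  I U (fun i u => - ln (bern b (u i))) t t0.
have e1 i : expect Pm (fun u : ffb => - ln (bern b (u i))) = ln 2 / k.
  by rewrite (expect_one (fun c => - ln (bern b c))) -bern_entropy; ring.
apply: le_trans (le_trans _ (cheb _)) _.
- rewrite [leLHS]big_mkcond [leRHS]big_mkcond; apply: ler_sum => u _.
  case: ifP => [tu|_]; last by case: ifP => // _; apply: (prodm_ge0 bern_ge0).
  rewrite ifT// (eq_bigr _ (fun i _ => e1 i)) sumr_cstl -/(loglik U u).
  by rewrite ger0_norm; lra.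
- by move=> i j _ _ ij; apply: (expect_two (fun c => - ln (bern b c)) ij).
rewrite ler_wpM2r ?invr_ge0 ?sqr_ge0//.
rewrite mulrC -sumr_cstl; apply: ler_sum => i _.
rewrite (expect_one (fun c => (- ln (bern b c)) ^+ 2)) !sqrrN.
exact: bern_ln2_moment.
Qed.

(** Freeing the inputs outside [U] and those in [A u] does not change the value. The cylinder so
    obtained has mass at least [expR (- (M - kap * a))], since each freed input of [A u] saves at
    least [kap]; then [card_imset_cylinder] applies. *)
Lemma typical_support (T : finType) (F : ffb -> T) (U : {set I})
    (A : ffb -> {set I}) (G : {set ffb}) (M a : R) :
  (forall u v : ffb, u \in G ->
     (forall i, i \in U -> i \notin A u -> v i = u i) -> F v = F u) ->
  (forall u, u \in G -> A u \subset U /\ a <= #|A u|%:R) ->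
  (forall u, u \in G -> loglik U u <= M) ->
  #|F @: G|%:R <= expR (M - kap * a).
Proof.
move=> FA Aa GM.
have H := @card_imset_cylinder R I (bern b) bern_ge0 bern_sum1 T F G
  (fun u => ~: U :|: A u) (expR (- (M - kap * a))).
rewrite -[leRHS]mul1r -ler_pdivrMr ?expR_gt0// -expRN; apply: H.
  move=> u v uG vu; apply: FA uG _ => i iU iA; apply: vu.
  by rewrite !inE iU (negbTE iA).
move=> u uG; have [AU aA] := Aa u uG.
have -> : \prod_(i in ~: (~: U :|: A u)) bern b (u i) =
    expR (\sum_(i in U :\: A u) ln (bern b (u i))).
  rewrite expR_sum; apply: eq_big => [i|i _]; last by rewrite lnK ?posrE ?bern_gt0.
  by rewrite !inE negb_or negbK andbC.
rewrite ler_expR.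
have split : loglik U u = - \sum_(i in U :\: A u) ln (bern b (u i)) + loglik (A u) u.
  rewrite /loglik (big_setID (A u))/= (setIidPr AU) addrC; congr (_ + _).
  by rewrite sumrN.
have lA : kap * a <= loglik (A u) u.
  apply: le_trans (_ : kap * #|A u|%:R <= _); first by rewrite ler_pM2l ?kap_gt0.
  rewrite mulrC -sumr_cstl; apply: ler_sum => i _; exact: kap_bern.
by have := GM u uG; rewrite split; lra.
Qed.

End Bernoulli.

End Entropy.

(** * The statistical test *)

Section PushForward.
Variables (R : realType) (l m : nat) (b : R) (f : l.-tuple bool -> m.-tuple bool).

Definition outp (u : {ffun 'I_l -> bool}) : m.-tuple bool := f (mktuple u).

Lemma push_bernE (y : m.-tuple bool) :
  push_bern b f y = \sum_(u | outp u == y) prodm (bern b) u.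
Proof.
rewrite /push_bern (reindex (fun u : {ffun 'I_l -> bool} => mktuple u))/=.
  apply: eq_bigr => u _; apply: eq_bigr => i _; by rewrite tnth_mktuple.
exists (fun x : l.-tuple bool => [ffun i => tnth x i]) => [u _|x _].
  by apply/ffunP => i; rewrite ffunE tnth_mktuple.
by apply: eq_from_tnth => i; rewrite tnth_mktuple ffunE.
Qed.

Lemma sum_push_bern (A : {set m.-tuple bool}) :
  \sum_(y in A) push_bern b f y = expect (prodm (bern b)) (fun u => (outp u \in A)%:R).
Proof.
rewrite /expect (eq_bigr (fun u => if outp u \in A then prodm (bern b) u else 0)).
  rewrite -big_mkcond/= (partition_big outp (mem A))//=.
  apply: eq_bigr => y yA; rewrite push_bernE; apply: eq_bigl => u.
  by case: eqP => [->|]; rewrite ?yA ?andbF.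
by move=> u _; case: ifP => _; rewrite ?mulr1 ?mulr0.
Qed.

Lemma push_bern_sum1 : \sum_y push_bern b f y = 1.
Proof.
transitivity (\sum_(y in [set: m.-tuple bool]) push_bern b f y).
  by apply: eq_bigl => y; rewrite inE.
rewrite sum_push_bern -[RHS](@expect_cst _ _ (@prodm R 'I_l (bern b))).
  by apply: eq_expect => u; rewrite inE.
by apply: prodm_sum1; apply: bern_sum1.
Qed.

End PushForward.

Lemma pmmajmod_bits (p n : nat) (y : seq bool) :
  pmmajmod p n (take (2 * n - 2) y) =
  MM p (\sum_(v : 'I_n | (0 < v)%N) sval n y v) (+)
  \big[addb/false]_(v : 'I_n | (0 < v)%N) xb n y v.
Proof.
have hE w : (w < n)%N -> hb (take (2 * n - 2) y) w = hb y w.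
  elim/ltn_ind: w => -[//|w] IH wn; rewrite /hb.
  rewrite (htree_parent (fun j => nth false (take (2 * n - 2) y) j.-1))//.
  rewrite (htree_parent (fun j => nth false y j.-1))//.
  congr (_ (+) _); first by rewrite nth_take//=; lia.
  by apply: IH => /=; lia.
have xE w : (0 < w)%N -> (w < n)%N -> nth false (take (2 * n - 2) y) (n.-1 + w.-1) = xb n y w.
  by move=> w0 wn; rewrite nth_take//; lia.
have range (T : Type) (idx : T) (op : Monoid.law idx) (phi : nat -> T) :
    \big[op/idx]_(1 <= i < n) phi i = \big[op/idx]_(v : 'I_n | (0 < v)%N) phi v.
  by rewrite big_geq_mkord; apply: eq_bigl => v.
rewrite /pmmajmod; congr (MM p _ (+) _).
  rewrite range; apply: eq_bigr => v v0; rewrite xE// /sval.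
  by case: ifP => // _; rewrite -/(hb _ v) hE.
rewrite range (big_morph odd oddD (erefl _)); apply: eq_bigr => v v0.
by rewrite xE// oddb.
Qed.

Lemma expR_ge_pow (R : realType) (x : R) (c : nat) : 0 <= 1 - x ->
  (1 - x) ^+ c <= expR (- (x * c%:R)).
Proof.
move=> x1; rewrite mulrC -mulrN expRM_natl lerXn2r ?nnegrE ?expR_ge0//.
exact: expR_ge1Dx.
Qed.

Section SwingBias.
Variables (R : realType) (p n r l : nat) (b : R).
Variable f : l.-tuple bool -> (2 * n - 2).+1.-tuple bool.
Variables (dep : nat -> {set 'I_l}) (S : {set 'I_l}).
Local Notation ffb := {ffun 'I_l -> bool}.
Local Notation F := (fun u : ffb => outp f u : seq bool).
Hypothesis p_pr : prime p.
Hypothesis p_odd : odd p.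
Hypothesis bern_b_ge0 : forall c, 0 <= bern b c.
Hypothesis dep_ok : forall j (u v : ffb),
  (forall i, i \in dep j -> u i = v i) -> nth false (F u) j = nth false (F v) j.
Hypothesis r_gt0 : (0 < r)%N.
Hypothesis S_low : forall i, i \in S -> low n r dep i.
Hypothesis S_disj : forall i j, i \in S -> j \in S -> i != j ->
  [disjoint region n r dep i & region n r dep j].
Hypothesis S_last : forall i, i \in S -> i \notin dep (2 * n - 2).
Hypothesis S_small : forall i, i \in S -> (2 * #|region n r dep i| < p)%N.

Definition correct (y : (2 * n - 2).+1.-tuple bool) : bool :=
  nth false y (2 * n - 2) == pmmajmod p n (take (2 * n - 2) y).

(** Correctness is [(1 + sign) / 2], where the sign is that of the last bit times that of
    [pmmajmod]. Given the inputs outside [S], the last bit is constant and the other sign is a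
    twisted walk, to which every swing contributes a contracting step. *)
Lemma correct_swing_bound (u : ffb) (m e : R) :
  m <= #|swing n r dep F S u|%:R ->
  0 <= e -> expR (- (2 * (bern b true * bern b false) / p%:R ^+ 2 * m)) * p%:R <= e ^+ 2 ->
  expect (prodm (bern b)) (fun w => (correct (outp f (mix S u w)))%:R)
    <= 1 / 2 + (p%:R^-1 + e) / 2.
Proof.
move=> mJ e0 He.
pose a i c : 'F_p := (rsum n r dep i (F (setc u i c)))%:~R.
pose sg i c := rpar n r dep i (F (setc u i c)).
pose g (t : 'F_p) : R := (-1) ^+ MMF t.
pose c0 : 'F_p := (\sum_(v : 'I_n | (0 < v)%N &&
  [forall i in S, v \notin region n r dep i]) sval n (F u) v)%:~R.
pose c1 : bool := \big[addb/false]_(v : 'I_n | (0 < v)%N &&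
  [forall i in S, v \notin region n r dep i]) xb n (F u) v.
pose lb := nth false (F u) (2 * n - 2).
have sgn w : (-1 : R) ^+ pmmajmod p n (take (2 * n - 2) (F (mix S u w))) =
    (-1) ^+ c1 * (g (c0 + \sum_(j <- enum S) a j (w j)) *
      \prod_(j <- enum S) (-1) ^+ sg j (w j)).
  rewrite pmmajmod_bits MM_MMF// signr_addb.
  have := mix_decomposition dep_ok r_gt0 S_low S_disj +%R
    (fun x h => if x then (if h then -1 else 1) else 0 : int) u w.
  rewrite /= -/(sval n _ _) => ->.
  have := mix_decomposition dep_ok r_gt0 S_low S_disj addb (fun x h => x) u w.
  rewrite /= => ->.
  rewrite -/c1 signr_addb mulrCA; congr (_ * _); congr (_ * _).
    rewrite /g rmorphD/= -/c0 rmorph_sum/= big_enum; congr ((-1) ^+ MMF (_ + _)).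
  rewrite (big_morph (fun x : bool => (-1 : R) ^+ x) (id1 := 1) (op1 := *%R)) //.
    by rewrite big_enum.
  exact: signr_addb.
have cE w : (correct (outp f (mix S u w)))%:R = 1 / 2 + (1 / 2) * ((-1) ^+ lb * (-1) ^+ c1 *
   (g (c0 + \sum_(j <- enum S) a j (w j)) * \prod_(j <- enum S) (-1) ^+ sg j (w j))) :> R.
  rewrite -(mulrA ((-1) ^+ lb)) -sgn /correct.
  have -> : nth false (outp f (mix S u w)) (2 * n - 2) = lb.
    by apply: (last_agree dep_ok S_last) => i /negbTE iS; rewrite ffunE iS.
  rewrite -signr_addb.
  by case: lb; case: (pmmajmod _ _ _) => /=; rewrite ?expr0 ?expr1; lra.
rewrite (eq_expect _ cE) expectD expect_cst ?prodm_sum1 ?bern_sum1// !expectZ.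
rewrite lerD2l [leRHS]mulrC div1r ler_pM2l//.
apply: le_trans (ler_norm _) _.
rewrite normrM normrM !normr_sign mul1r mul1r.
apply: (@walkE_bias R p 'I_l (bern b) p_pr p_odd bern_b_ge0 (bern_sum1 b) a sg
  (enum S) g c0 e) => //.
- exact: enum_uniq.
- by move=> t; rewrite normr_sign.
- by rewrite sum_MMF// normr1.
apply: le_trans He; rewrite ler_wpM2r//.
have cJ : (#|swing n r dep F S u| <= count (fun i => a i true != a i false) (enum S))%N.
  rewrite -sum1_count big_enum_cond/= -sum1_card.
  rewrite [leqLHS]big_mkcond [leqRHS]big_mkcond; apply: leq_sum => i _.
  case: ifP => // iJ; have iS : i \in S by move: iJ; rewrite inE => /andP[].
  by rewrite iS /= ifT//; apply: (swing_rsum r_gt0 p_pr iJ); apply: S_small.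
have x0 : 0 <= 2 * (bern b true * bern b false) / p%:R ^+ 2.
  by rewrite divr_ge0 ?exprn_ge0// mulr_ge0// mulr_ge0.
apply: le_trans (expR_ge_pow _ _) _.
  exact: (contraction_ge0 p_pr (bern_sum1 b)).
rewrite ler_expR lerN2 ler_wpM2l//; apply: le_trans mJ _.
by rewrite ler_nat.
Qed.

End SwingBias.

(** * Combining the tests into bounds on the distance *)

Section Assembly.
Variables (R : realType) (p n l : nat) (b k : R).
Variable f : l.-tuple bool -> (2 * n - 2).+1.-tuple bool.
Variable dep : nat -> {set 'I_l}.
Local Notation N := (2 * n - 2)%N.
Local Notation ffb := {ffun 'I_l -> bool}.
Local Notation F := (fun u : ffb => outp f u : seq bool).
Local Notation Pm := (@prodm R 'I_l (bern b)).
Hypothesis b_bnd : -(1/2) <= b <= 1/2.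
Hypothesis k_ge1 : 1 <= k.
Hypothesis Hb : Hbern b = k^-1.
Hypothesis dep_ok : forall j (u v : ffb),
  (forall i, i \in dep j -> u i = v i) -> nth false (F u) j = nth false (F v) j.

Definition used : {set 'I_l} := [set i | [exists j : 'I_N.+1, i \in dep j]].

Lemma eq_outp (u v : ffb) : (forall j, (j <= N)%N -> nth false (F u) j = nth false (F v) j) ->
  outp f u = outp f v.
Proof.
move=> H; apply: val_inj; apply: (@eq_from_nth _ false); first by rewrite !size_tuple.
by move=> j; rewrite size_tuple ltnS; apply: H.
Qed.

Lemma outp_used (u v : ffb) : (forall i, i \in used -> u i = v i) ->
  outp f u = outp f v.
Proof.
move=> uv; apply: eq_outp => j jN; apply: dep_ok => i ij; apply: uv.
by rewrite inE; apply/existsP; exists (Ordinal (jN : (j < N.+1)%N)).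
Qed.

(** The mean information content of the used inputs plus the slack [t]. *)
Let M (t : R) : R := #|used|%:R * (ln 2 / k) + t.

Definition typical (t : R) : {set ffb} := [set u | loglik b used u < M t].

Lemma typical_compl (t : R) : 0 < t ->
  expect Pm (fun u => (u \notin typical t)%:R) <= 8 * #|used|%:R / t ^+ 2.
Proof.
move=> t0; apply: le_trans (typical_prob b_bnd k_ge1 Hb used t0).
rewrite /expect [leRHS]big_mkcond; apply: ler_sum => u _.
by rewrite inE -leNgt; case: ifP => _; rewrite ?mulr1 ?mulr0.
Qed.

Lemma push_event_ge (T : {set N.+1.-tuple bool}) (e : R) :
  expect Pm (fun u => (outp f u \notin T)%:R) <= e ->
  1 - e <= \sum_(y in T) push_bern b f y.
Proof.
move=> He; rewrite sum_push_bern.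
have : expect Pm (fun u => (outp f u \in T)%:R) +
    expect Pm (fun u => (outp f u \notin T)%:R) = 1.
  rewrite -expectD -[RHS](@expect_cst _ _ Pm) ?prodm_sum1 ?bern_sum1//.
  by apply: eq_expect => u; case: (_ \in T); rewrite ?addr0 ?add0r.
by move: He; lra.
Qed.

Lemma target_event_le (T : {set N.+1.-tuple bool}) (e : R) :
  #|T|%:R <= e * 2 ^+ N -> \sum_(y in T) target p n y <= e.
Proof.
move=> He; apply: le_trans (_ : #|T|%:R * (2 ^+ N)^-1 <= _).
  by rewrite -sumr_cstl; apply: ler_sum => y _; apply: target_le.
by rewrite ler_pdivrMr// exprn_gt0.
Qed.

(* Few used inputs: the image of the typical inputs is already negligible. *)
Lemma tvd_few_inputs (t e1 e3 : R) : 0 < t ->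
  8 * #|used|%:R / t ^+ 2 <= e1 -> expR (M t) <= e3 * 2 ^+ N ->
  1 - e1 - e3 <= tvd (push_bern b f) (target p n).
Proof.
move=> t0 He1 He3.
pose T := [set outp f u | u in typical t].
have hT : 1 - e1 <= \sum_(y in T) push_bern b f y.
  apply: push_event_ge; apply: le_trans He1; apply: le_trans (typical_compl t0).
  apply: le_expect; first exact/prodm_ge0/(bern_ge0 b_bnd k_ge1 Hb).
  move=> u; case: (boolP (u \in typical t)) => [ut|_]; last by rewrite lern1 leq_b1.
  by have -> : outp f u \in T by apply: imset_f.
have hQ : \sum_(y in T) target p n y <= e3.
  apply: target_event_le; apply: le_trans He3.
  have := @typical_support R b k b_bnd k_ge1 Hb 'I_l _ (outp f) used (fun=> set0)
    (typical t) (M t) 0.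
  rewrite mulr0 subr0; apply.
  - move=> u v _ vu; apply: outp_used => i iU; apply: vu => //; by rewrite inE.
  - by move=> u _; rewrite sub0set.
  - by move=> u; rewrite inE => /ltW.
have := tvd_ge_event T (push_bern_sum1 b f) (target_sum1 R n p).
by move: hT hQ; lra.
Qed.

Variable dn : nat.
Hypothesis dn_gt0 : (0 < dn)%N.
Hypothesis card_dep : forall j, (#|dep j| <= dn)%N.
Hypothesis n_large : (4 * dn + 4 <= n)%N.
Hypothesis p_pr : prime p.
Hypothesis p_odd : odd p.
Local Notation B := (128 * dn ^ 2)%N.
Hypothesis p_large : (2 * B < p)%N.

(** The test [T] accepts the small image [TF], few hits [T0] and a wrong last bit [TS]. Its target
    mass is at most [e3 + e2 + 0]. The output escapes it only if the input is atypical, or if there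
    are [m / 4] swings and the last bit is correct. *)
Lemma tvd_many_inputs (t e1 e2 e3 e4 : R) :
  let m := n%:R * (1 / 2) ^+ (3 * B) in
  (n.-1 <= #|used|)%N -> 0 < t ->
  8 * #|used|%:R / t ^+ 2 <= e1 ->
  4 / m <= e2 ->
  expR (M t - kap b * (m / 4)) <= e3 * 2 ^+ N ->
  0 <= e4 ->
  expR (- (2 * kap b / p%:R ^+ 2 * (m / 4))) * p%:R <= e4 ^+ 2 ->
  1 / 2 - (e1 + e2 + e3 + (p%:R^-1 + e4) / 2) <= tvd (push_bern b f) (target p n).
Proof.
move=> m cU t0 He1 He2 He3 e40 He4.
have [S [SU cS Slow [Sdisj Slast] Ssize]] := selection dn_gt0 card_dep n_large cU.
set r := up_log 2 (8 * dn) in Slow Sdisj Ssize.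
have r0 : (0 < r)%N by apply: height_gt0.
have bge0 := bern_ge0 b_bnd k_ge1 Hb.
have Pge0 := @prodm_ge0 R 'I_l (bern b) bge0.
have n0 : (0 < n)%N by apply: leq_trans n_large; rewrite addn_gt0 orbT.
have m0 : 0 < m by rewrite mulr_gt0 ?ltr0n// exprn_gt0.
(* Of the exponent [3 * B], one [B] pays for passing from [n] to [#|S|] and [2 * B] for the
   probability of a hit. *)
have mS : m <= #|S|%:R * (1 / 2) ^+ (2 * B).
  rewrite /m (mulSn 2).
  rewrite exprD mulrA ler_wpM2r ?exprn_ge0//.
  rewrite div1r exprVn ler_pdivrMr ?exprn_gt0// -natrX -natrM ler_nat//.
pose sw := swing n r dep F S; pose fz := frozen n r dep F S.
pose hits (y : seq bool) := #|[set i in S | hit n r dep y i]|.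
pose G := [set u in typical t | m / 4 <= #|fz u|%:R].
pose TF := [set outp f u | u in G].
pose T0 := [set y : N.+1.-tuple bool | (hits y)%:R <= m / 2].
pose TS := [set y : N.+1.-tuple bool | ~~ correct p y].
pose T := TF :|: T0 :|: TS.
have fzU u : fz u \subset used.
  by apply: fintype.subset_trans SU; apply/fintype.subsetP => i; rewrite inE => /andP[].
have qF : \sum_(y in TF) target p n y <= e3.
  apply: target_event_le; apply: le_trans He3.
  apply: (@typical_support R b k b_bnd k_ge1 Hb 'I_l _ (outp f) used fz G).
  - move=> u v _ vu.
    pose v' : ffb := [ffun i => if i \in used then v i else u i].
    transitivity (outp f v').
      by apply: outp_used => i iU; rewrite ffunE iU.
    apply: eq_outp => j; apply: (frozen_cylinder dep_ok r0 Slow Sdisj Slast) => i iF.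
    by rewrite ffunE; case: ifP => // iU; apply: vu.
  - by move=> u; rewrite inE => /andP[].
  - by move=> u; rewrite !inE => /andP[/ltW].
have q0 : \sum_(y in T0) target p n y <= e2.
  apply: le_trans He2; apply: le_trans (target_few_hits p Sdisj m0 Ssize mS).
  by rewrite le_eqVlt; apply/orP; left; apply/eqP; apply: eq_bigl => y; rewrite inE.
have qS : \sum_(y in TS) target p n y = 0 :> R.
  by rewrite big1// => y; rewrite inE /correct /target => /negbTE->.
have qT : \sum_(y in T) target p n y <= e3 + e2.
  have union (A C : {set N.+1.-tuple bool}) : \sum_(y in A :|: C) target p n y <=
      \sum_(y in A) target p n y + \sum_(y in C) target p n y :> R.
    rewrite [leLHS]big_mkcond [X in _ <= X + _]big_mkcond [X in _ <= _ + X]big_mkcond.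
    rewrite -big_split; apply: ler_sum => y _; rewrite inE.
    have := target_ge0 R p y.
    by case: (y \in A); case: (y \in C) => /=; lra.
  apply: le_trans (union _ _) _; rewrite qS addr0.
  by apply: le_trans (union _ _) _; apply: lerD.
have miss : expect Pm (fun u => (outp f u \notin T)%:R) <=
    e1 + (1 / 2 + (p%:R^-1 + e4) / 2).
  pose bad (u : ffb) : R := (m / 4 <= #|sw u|%:R)%R%:R * (correct p (outp f u))%:R.
  apply: (@le_trans _ _ (expect Pm (fun u => (u \notin typical t)%:R + bad u))).
    apply: le_expect => // u; rewrite /bad.
    have [uT|uT] := boolP (outp f u \in T).
      by rewrite addr_ge0// mulr_ge0.
    have [ut|_] /= := boolP (u \in typical t); last first.
      by rewrite lerDl mulr_ge0.
    move: uT; rewrite !inE !negb_or negbK -ltNge => /andP[/andP[uF u0] ->].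
    (* Outside [TF] fewer than [m / 4] inputs are frozen, and outside [T0] there are more than
       [m / 2] hits, so at least [m / 4] inputs swing. *)
    have fzlt : #|fz u|%:R < m / 4.
      rewrite ltNge; apply: contra uF => mf; apply: imset_f.
      by rewrite inE ut.
    have hle : (hits (outp f u))%:R <= #|sw u|%:R + #|fz u|%:R :> R.
      by rewrite -natrD ler_nat; apply: card_hit.
    have -> : m / 4 <= #|sw u|%:R by move: u0 fzlt hle; lra.
    by rewrite mulr1 add0r.
  rewrite expectD; apply: lerD; first exact: le_trans (typical_compl t0) He1.
  rewrite (expect_resample (bern_sum1 b) S).
  rewrite -[leRHS](@expect_cst _ _ Pm) ?prodm_sum1 ?bern_sum1//.
  apply: le_expect => // u.
  have swE w : sw (mix S u w) = sw u.
    apply: (eq_swing dep_ok r0 Slow Sdisj) => i /negbTE iS.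
    by rewrite ffunE iS.
  have p0 : 0 <= p%:R^-1 :> R by rewrite invr_ge0.
  have [mJ|mJ] := boolP (m / 4 <= #|sw u|%:R); last first.
    rewrite (eq_expect _ (Z := fun=> 0)); last first.
      by move=> w; rewrite /bad swE (negbTE mJ) mul0r.
    by rewrite expect_cst ?prodm_sum1 ?bern_sum1//; lra.
  rewrite (eq_expect _ (Z := fun w => (correct p (outp f (mix S u w)))%:R)); last first.
    by move=> w; rewrite /bad swE mJ mul1r.
  apply: (@correct_swing_bound R p n r l b f dep S p_pr p_odd bge0 dep_ok r0 Slow
    Sdisj Slast _ u (m / 4) e4) => //.
  by move=> i iS; apply: leq_ltn_trans p_large; rewrite leq_mul2l Ssize.
have pT := push_event_ge miss.
have := tvd_ge_event T (push_bern_sum1 b f) (target_sum1 R n p).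
by move: pT qT; lra.
Qed.

End Assembly.

(** * Asymptotics *)

Section Asymptotics.
Variable R : realType.

Lemma natr_powR_large (a C : R) : 0 < a ->
  exists n0 : nat, forall N : nat, (n0 <= N)%N -> C <= N%:R `^ a.
Proof.
move=> a0; pose D := Num.max C 1.
have D0 : 0 <= D by rewrite le_max ler01 orbT.
exists (Num.truncn (D `^ a^-1)).+1 => N HN.
apply: le_trans (_ : D <= _); first by rewrite le_max lexx.
have -> : D = (D `^ a^-1) `^ a by rewrite -powRrM mulVf ?gt_eqF// powRr1.
apply: ge0_ler_powR; rewrite ?nnegrE ?powR_ge0 ?ler0n// ?ltW//.
by apply: lt_le_trans (truncnS_gt _) _; rewrite ler_nat.
Qed.

(** Write [N ^ a = y * y] with [y = N ^ (a / 2)]: one factor absorbs the constant, the other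
    dominates [ln y]. *)
Lemma ln_natr_le_powR (a K : R) : 0 < a ->
  exists n0 : nat, forall N : nat, (n0 <= N)%N -> K * ln N%:R <= N%:R `^ a.
Proof.
move=> a0; have a20 : 0 < a / 2 by rewrite divr_gt0.
have [n0 H] := natr_powR_large (`|K| / (a / 2)) a20.
exists n0.+1 => N HN.
have x0 : 0 < (N%:R : R) by rewrite ltr0n; lia.
have x1 : 1 <= (N%:R : R) by rewrite ler1n; lia.
set y := N%:R `^ (a / 2); have y0 : 0 < y by apply: powR_gt0.
have lnE : ln (N%:R : R) = ln y / (a / 2).
  by rewrite /y ln_powR mulrAC divff ?mul1r// gt_eqF.
have yK : `|K| / (a / 2) <= y by apply: H; lia.
have -> : N%:R `^ a = y * y.
  by rewrite /y -powRD ?(gt_eqF x0) ?implybT//; congr (_ `^ _); lra.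
apply: le_trans (_ : `|K| * ln N%:R <= _).
  by rewrite ler_wpM2r ?ln_ge0// ler_norm.
rewrite lnE mulrCA mulrC; apply: ler_pM => //.
- by rewrite divr_ge0 // ltW.
- apply: ln_ge0; have := @ler_powR R N%:R x1 0 (a / 2) (ltW a20).
  by rewrite powRr0.
by have := ln_le_sub1 y0; lra.
Qed.

Lemma ln_natr_large (K : R) :
  exists n0 : nat, forall N : nat, (n0 <= N)%N -> K <= ln N%:R.
Proof.
exists (Num.truncn (expR K)).+1 => N HN.
rewrite -[K]expRK ler_ln ?posrE ?expR_gt0//.
  by apply/ltW/(lt_le_trans (truncnS_gt _)); rewrite ler_nat.
by rewrite ltr0n; lia.
Qed.

End Asymptotics.

Section Locality.
Variables (R : realType) (l m : nat) (d : R).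
Variable f : l.-tuple bool -> m.-tuple bool.

Lemma local_dep : local d f -> exists dep : nat -> {set 'I_l},
  (forall j, (#|dep j| <= Num.truncn d)%N) /\
  forall j (u v : {ffun 'I_l -> bool}),
    (forall i, i \in dep j -> u i = v i) ->
    nth false (outp f u) j = nth false (outp f v) j.
Proof.
move=> /fin_all_exists[S HS].
exists (fun j => if insub j is Some q then S q else set0); split => j.
  case: insubP => [q _ _ | _]; last by rewrite cards0.
  have [cS _] := HS q.
  have d0 : 0 <= d by apply: le_trans cS.
  by rewrite truncn_ge_nat.
move=> u v; case: insubP => [q jm qj uv|jm _]; last first.
  by rewrite !nth_default ?size_tuple// leqNgt.
have [_ {}HS] := HS q.
rewrite -qj -!tnth_nth; apply: HS => i iS.
by rewrite !tnth_mktuple uv.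
Qed.

End Locality.

(** * Choice and comparison of the parameters *)

Section Estimates.
Variable R : realType.

Lemma powR_expR (x a : R) : 0 < x -> x `^ a = expR (a * ln x).
Proof. by move=> x0; rewrite /powR gt_eqF. Qed.

(** [Q] will bound [kap b * m] from below and [t] is the slack for typical inputs. The exponent
    [2 / 3] makes [t ^ 2] beat [x * L ^ 2] and keeps [t] below [Q], as [2 / 3 + 1 / 6 <= 1 - theta].
    The last bound holds since [1 / 6 + 2 * alpha <= 1 - theta]. *)
Lemma parameter_estimates (delta alpha theta eps c1 c2 : R) :
  0 < alpha < 1 / 3 -> 0 < theta -> theta <= (1 - delta) / 2 -> theta <= 1 / 6 ->
  0 < eps <= 1 -> 0 < c1 -> 0 < c2 ->
  exists n0 : nat, forall N : nat, (n0 <= N)%N ->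
  let x : R := N%:R in let L := ln x in let Q := x `^ (1 - theta) in
  let t := x `^ (2 / 3) in
  [/\ [/\ 1 <= x, 1 <= L, 1 <= eps * L & 16 * L <= x],
      L <= c1 * x `^ alpha /\ x `^ alpha <= x,
      16 * L ^+ 2 * x <= t ^+ 2 /\ t + L <= x / 4,
      2 * (x `^ (theta / 2)) * Q <= x &
      [/\ x `^ delta + t + L <= Q / 4, 4 * L <= Q &
          (c2 + 3 * L) * (2 * (c2 * x `^ alpha) ^+ 2) <= Q]].
Proof.
move=> /andP[a0 a3] th0 thd th6 /andP[e0 e1] c10 c20.
have th20 : 0 < theta / 2 by lra.
have s0 : 0 < 1 / 6 :> R by lra.
have [n1 H1] := ln_natr_large (1 / eps).
have [n2 H2] := ln_natr_le_powR 16 (@ltr01 R).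
have [n3 H3] := ln_natr_le_powR (c1^-1) a0.
have [n4 H4] := ln_natr_le_powR 16 s0.
have [n5 H5] := ln_natr_le_powR 4 th20.
have [n6 H6] := ln_natr_le_powR ((c2 + 3) * (2 * c2 ^+ 2)) s0.
exists (n1 + n2 + n3 + n4 + n5 + n6).+1 => N HN x L Q t.
have {}H1 : 1 / eps <= L by apply: H1; move: HN; clear; lia.
have {}H2 : 16 * L <= x `^ 1 by apply: H2; move: HN; clear; lia.
have {}H3 : c1^-1 * L <= x `^ alpha by apply: H3; move: HN; clear; lia.
have {}H4 : 16 * L <= x `^ (1 / 6) by apply: H4; move: HN; clear; lia.
have {}H5 : 4 * L <= x `^ (theta / 2) by apply: H5; move: HN; clear; lia.
have {}H6 : (c2 + 3) * (2 * c2 ^+ 2) * L <= x `^ (1 / 6) by apply: H6; move: HN; clear; lia.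
have x1 : 1 <= x by rewrite ler1n; move: HN; clear; lia.
have x0 : 0 < x by apply: lt_le_trans x1.
rewrite powRr1 ?(ltW x0)// in H2.
have eL : 1 <= eps * L by rewrite -ler_pdivrMl// mulr1 -div1r.
have L1 : 1 <= L.
  apply: le_trans eL _; rewrite -[leRHS]mul1r ler_wpM2r//.
  by apply: ln_ge0.
have pD a c : x `^ (a + c) = x `^ a * x `^ c by rewrite powRD// (gt_eqF x0) implybT.
have mono a c : a <= c -> x `^ a <= x `^ c by apply: ler_powR.
have pos a : 0 < x `^ a by apply: powR_gt0.
have xE : x = x `^ 1 by rewrite powRr1// ltW.
have s16 : 16 <= x `^ (1 / 6) by lra.
have t2E : t ^+ 2 = x * (x `^ (1 / 6) * x `^ (1 / 6)).
  by rewrite [X in _ = X * _]xE -!pD expr2 /t -pD; congr (_ `^ _); lra.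
have tsQ : t * x `^ (1 / 6) <= Q by rewrite /t /Q -pD; apply: mono; lra.
have dtQ : x `^ delta * (x `^ (theta / 2) * x `^ (theta / 2)) <= Q.
  by rewrite /Q -!pD; apply: mono; lra.
have sQ : x `^ (1 / 6) <= Q by apply: mono; lra.
have Q0 := pos (1 - theta); rewrite -/Q in Q0.
have t0 : 0 < t := pos _.
have d0 := pos delta.
have tx : t * x `^ (1 / 6) * x `^ (1 / 6) = x.
  rewrite /t -!pD [RHS]xE; congr (_ `^ _); lra.
have t16 : 16 * t <= Q.
  by apply: le_trans tsQ; rewrite mulrC ler_wpM2l// ltW.
have d16 : 16 * x `^ delta <= Q.
  apply: le_trans dtQ; rewrite mulrC ler_wpM2l ?(ltW d0)//.
  have h4 : 4 <= x `^ (theta / 2) by lra.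
  nra.
split.
- by split.
- split; last by rewrite [leRHS]xE; apply: mono; lra.
  by rewrite -ler_pdivrMl.
- split.
    have h : (16 * L) ^+ 2 <= (x `^ (1 / 6)) ^+ 2.
      by rewrite ler_sqr ?nnegrE ?(ltW (pos _))//; lra.
    rewrite t2E [leLHS]mulrC ler_pM2l// -[leRHS]expr2; apply: le_trans h.
    by have := sqr_ge0 L; rewrite exprMn; lra.
  have : 256 * t <= x.
    rewrite -[leRHS]tx -[leRHS]mulrA [leLHS]mulrC ler_pM2l//.
    by have := @ler_pM R 16 _ 16 _ (ler0n _ _) (ler0n _ _) s16 s16; lra.
  by lra.
- have xQE : x `^ (theta / 2) * x `^ (theta / 2) * Q = x.
    by rewrite /Q -!pD [RHS]xE; congr (_ `^ _); lra.
  by rewrite -[leRHS]xQE !ler_pM2r//; lra.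
- split; [lra|lra|].
  have aaQ : x `^ (1 / 6) * (x `^ alpha * x `^ alpha) <= Q.
    by rewrite /Q -!pD; apply: mono; lra.
  apply: le_trans aaQ.
  have -> : (c2 + 3 * L) * (2 * (c2 * x `^ alpha) ^+ 2) =
    (c2 + 3 * L) * (2 * c2 ^+ 2) * (x `^ alpha * x `^ alpha) by ring.
  rewrite ler_wpM2r ?mulr_ge0 ?(ltW (pos _))//; apply: le_trans H6.
  have c22 : 0 < 2 * c2 ^+ 2 by rewrite mulr_gt0// exprn_gt0.
  rewrite mulrAC ler_wpM2r ?(ltW c22)//; nra.
Qed.

Lemma card_used (n l dn : nat) (dep : nat -> {set 'I_l}) :
  (forall j, (#|dep j| <= dn)%N) -> (#|used n dep| <= dn * (2 * n - 2).+1)%N.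
Proof.
move=> card_dep; apply: (@leq_trans #|\bigcup_(j < (2 * n - 2).+1) dep j|).
  apply: subset_leq_card; apply/fintype.subsetP => i; rewrite inE => /existsP[j ij].
  by apply/bigcupP; exists j.
apply: (@leq_trans (\sum_(j < (2 * n - 2).+1) dn)); last first.
  by rewrite sum_nat_const card_ord mulnC.
elim/big_rec2: _ => [|j c A _ IH]; first by rewrite cards0.
by apply: leq_trans (leq_card_setU _ _) _; apply: leq_add.
Qed.

(** By [kap_ge] and [k <= 4 * dn], [1 / kap b] is at most [64 * (4 * dn) ^ 2], which is [8] times
    the region bound [B = 128 * dn ^ 2], and [8 * B <= 2 ^ B]. *)
Lemma kap_ge_pow (b k : R) (dn : nat) : (0 < dn)%N ->
  -(1/2) <= b <= 1/2 -> 1 <= k -> Hbern b = k^-1 -> k <= 4 * dn%:R ->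
  (1 / 2) ^+ (128 * dn ^ 2) <= kap b.
Proof.
move=> dn0 bb k1 Hb k4; apply: le_trans (kap_ge bb k1 Hb).
have k0 : 0 < k by move: k1; clear; lra.
set B := (128 * dn ^ 2)%N.
have B128 : (128 <= B)%N by rewrite /B leq_pmulr// expn_gt0 dn0.
have BR : (B%:R : R) = 128 * dn%:R ^+ 2 by rewrite /B natrM natrX.
rewrite div1r exprVn div1r lef_pV2 ?posrE ?exprn_gt0 ?mulr_gt0 ?exprn_gt0//.
apply: le_trans (_ : (8 * B)%:R <= _).
  rewrite natrM BR.
  have : k ^+ 2 <= (4 * dn%:R) ^+ 2 by rewrite ler_sqr ?nnegrE ?mulr_ge0// ltW.
  by clear; lra.
by rewrite -natrX ler_nat; apply: leq_trans (sqr_lt_exp2 _); move: B128; clear; nia.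
Qed.

Lemma pow_region_le (x theta : R) (dn : nat) : 0 < x ->
  dn%:R ^+ 2 <= theta / 1024 * ln x ->
  (2 : R) ^+ (4 * (128 * dn ^ 2)) <= x `^ (theta / 2).
Proof.
move=> x0 dn2.
rewrite powR_expR// -[2 in leLHS]lnK ?posrE// -expRM_natl ler_expR natrM (natrM _ 128) natrX.
apply: le_trans (_ : 4 * (128 * dn%:R ^+ 2) <= _).
  by rewrite ler_piMr ?ln2_le// !mulr_ge0// exprn_ge0.
by move: dn2; clear; lra.
Qed.

End Estimates.

Theorem theoremC2 (R : realType) :
  forall delta : R, 0 <= delta < 1 ->
  forall alpha : R, delta / 3 < alpha < 1 / 3 ->
  exists eps : R, 0 < eps /\
  forall c1 c2 : R, 0 < c1 -> c1 <= c2 ->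
  exists C : R, 0 < C /\ exists n0 : nat,
  forall n : nat, (n0 <= n)%N ->
  forall p : nat, prime p ->
    c1 * ((2 * n - 2)%:R `^ alpha) <= p%:R <= c2 * ((2 * n - 2)%:R `^ alpha) ->
  forall k b : R, 1 <= k -> -(1/2) <= b <= 1/2 -> Hbern b = k^-1 ->
  forall l : nat, l%:R <= k * (2 * n - 2)%:R + (2 * n - 2)%:R `^ delta ->
  forall f : l.-tuple bool -> (2 * n - 2).+1.-tuple bool,
    local (Num.sqrt (eps * ln ((2 * n - 2)%:R))) f ->
    tvd (push_bern b f) (target p n) >= 1/2 - C / ln ((2 * n - 2)%:R).
Proof.
move=> delta /andP[d0 d1] alpha /andP[da a3].
(* With this exponent [N ^ (1 - theta)] dominates [N ^ delta], [N ^ (2 / 3)] and [p ^ 2 * ln N]. *)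
pose theta := Num.min ((1 - delta) / 2) (1 / 6).
have th0 : 0 < theta by rewrite lt_min; apply/andP; split; lra.
have thd : theta <= (1 - delta) / 2 by rewrite ge_min lexx.
have th6 : theta <= 1 / 6 by rewrite ge_min lexx orbT.
(* Then [4 * B = 512 * dn ^ 2 <= (theta / 2) * ln N], so the total loss [2 ^ (4 * B)] is at most
   [N ^ (theta / 2)]. *)
exists (theta / 1024); split; first by lra.
move=> c1 c2 c10 c12; have c20 : 0 < c2 by lra.
(* Each of [e1], [e2], [e3], [e4] and [1 / p] will be at most [1 / L], and the last two enter
   halved. *)
exists 4; split; first by lra.
have aa : 0 < alpha < 1 / 3 by apply/andP; split; lra.
have ee : 0 < theta / 1024 <= 1 by apply/andP; split; lra.
have [n1 Hest] := parameter_estimates aa th0 thd th6 ee c10 c20.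
exists (n1 + 2)%N => n nn0 p p_pr /andP[pc1 pc2] k b k1 bb Hb l lk f floc.
have HN : (n1 <= 2 * n - 2)%N by move: nn0; clear; lia.
have [[x1 L1 eL x16] [La ax] [tt tL] xQ [dQ LQ cQ]] := Hest _ HN.
move: x1 L1 eL x16 La ax tt tL xQ dQ LQ cQ pc1 pc2 lk floc.
have [x xE] : exists x : R, x = (2 * n - 2)%:R by exists (2 * n - 2)%:R.
have [L LE] : exists L, L = ln x by exists (ln x).
have [Q QE] : exists Q, Q = x `^ (1 - theta) by exists (x `^ (1 - theta)).
have [t tE] : exists t, t = x `^ (2 / 3) by exists (x `^ (2 / 3)).
rewrite /= -!xE -!LE -!QE -!tE => {HN Hest}.
move=> x1 L1 eL x16 La ax tt tL xQ dQ LQ cQ pc1 pc2 lk floc.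
have x0 : 0 < x by apply: lt_le_trans x1.
have L0 : 0 < L by apply: lt_le_trans L1.
have k0 : 0 < k by apply: lt_le_trans k1.
have t0 : 0 < t by rewrite tE; apply: powR_gt0.
have xn : x = 2 * n%:R - 2.
  by rewrite xE natrB ?natrM//; move: nn0; clear; lia.
have [dep [card_dep dep_ok]] := local_dep floc.
set dn := Num.truncn _ in card_dep.
have dn0 : (0 < dn)%N by rewrite truncn_gt0 -[leLHS]sqrtr1 ler_wsqrtr.
have dn2 : (dn%:R : R) ^+ 2 <= theta / 1024 * L.
  rewrite -[leRHS]sqr_sqrtr; last exact: le_trans eL.
  by rewrite ler_sqr ?nnegrE ?sqrtr_ge0// truncn_le sqrtr_ge0.
have dnn1 : 1 <= dn%:R :> R by rewrite ler1n.
have dnL : 6144 * dn%:R ^+ 2 <= L.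
  have : theta * L <= 1 / 6 * L by rewrite ler_wpM2r ?(ltW L0).
  by move: dn2; clear; lra.
have dnsq : dn%:R <= dn%:R ^+ 2 :> R by rewrite expr2 ler_peMl.
clearbody dn; set U := used n dep.
have cU : #|U|%:R <= dn%:R * (x + 1).
  by rewrite xE natr1 -natrM ler_nat; apply: card_used.
have dnL' : dn%:R <= L by move: dnL dnsq dnn1; clear; lra.
have cUL : #|U|%:R <= 2 * x * L.
  apply: le_trans cU _; rewrite [leRHS]mulrC; apply: ler_pM => //.
    by move: x0; clear; lra.
  by move: x1; clear; lra.
have Ul : #|U|%:R <= l%:R :> R.
  by rewrite ler_nat -[leqRHS]card_ord; apply: max_card.
have e1 : 8 * #|U|%:R / t ^+ 2 <= L^-1.
  rewrite ler_pdivrMr ?exprn_gt0// ler_pdivlMl//; apply: le_trans tt.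
  have : L * #|U|%:R <= L * (2 * x * L) by rewrite ler_pM2l.
  by clear; lra.
have twoN : (2 : R) ^+ (2 * n - 2) = expR (x * ln 2).
  by rewrite xE expRM_natl lnK ?posrE.
have Linv : L^-1 = expR (- ln L) by rewrite expRN lnK ?posrE.
have lnL : ln L <= L - 1 by apply: ln_le_sub1.
have l2 := @ln2_ge R; have l2' := @ln2_le R.
have l20 : 0 <= ln 2 :> R by move: l2; clear; lra.
have Li0 : 0 <= L^-1 by rewrite invr_ge0 ltW.
(* At most [k * x / 2] used inputs carry about [N / 2] bits of entropy, too few to fill the target.
   Otherwise at least [n.-1] inputs are used, and locality forces [k <= 4 * dn]. *)
have [Usmall|Ularge] := lerP #|U|%:R (k * x / 2).
  have He3 : expR (#|U|%:R * (ln 2 / k) + t) <= L^-1 * 2 ^+ (2 * n - 2).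
    rewrite twoN Linv -expRD ler_expR.
    have h : #|U|%:R * (ln 2 / k) <= x * ln 2 / 2.
      have -> : x * ln 2 / 2 = (k * x / 2) * (ln 2 / k).
        by field; rewrite gt_eqF.
      by rewrite ler_wpM2r// divr_ge0// ltW.
    have h' : x * (1 / 2) <= x * ln 2 by rewrite ler_pM2l.
    by move: h h' tL lnL; clear; lra.
  have := tvd_few_inputs p bb k1 Hb dep_ok t0 e1 He3.
  by move: Li0; clear; lra.
have xk : x <= k * x by rewrite ler_peMl// ltW.
have nU : (n.-1 <= #|U|)%N.
  rewrite -(@ler_nat R) -subn1 natrB; last by move: nn0; clear; lia.
  by move: xk xn Ularge; clear; lra.
have k4 : k <= 4 * dn%:R.
  have h : dn%:R * (x + 1) <= dn%:R * (2 * x).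
    by rewrite ler_wpM2l//; move: x1; clear; lra.
  have : k * x < 4 * dn%:R * x by move: h Ularge cU; clear; lra.
  by rewrite ltr_pM2r// => /ltW.
have BR : ((128 * dn ^ 2)%:R : R) = 128 * dn%:R ^+ 2 by rewrite natrM natrX.
have p_large : (2 * (128 * dn ^ 2) < p)%N.
  rewrite -(@ltr_nat R) natrM BR.
  by move: dnL La pc1 dnn1 dnsq; clear; lra.
have p_odd : odd p.
  case: (even_prime p_pr) => // p2; move: p_large dn0; rewrite p2; clear.
  by case: (dn) => // d; rewrite -mulnn; nia.
have n_large : (4 * dn + 4 <= n)%N.
  rewrite -(@ler_nat R) natrD natrM.
  by move: dnL dnsq dnn1 x16 xn; clear; lra.
pose m : R := n%:R * (1 / 2) ^+ (3 * (128 * dn ^ 2)).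
have m0 : 0 <= m by rewrite mulr_ge0// exprn_ge0.
have kap0 := kap_gt0 bb k1 Hb.
have kapB := kap_ge_pow dn0 bb k1 Hb k4.
have pow4B : (2 : R) ^+ (4 * (128 * dn ^ 2)) <= x `^ (theta / 2).
  by apply: pow_region_le => //; rewrite -LE.
have Q0 : 0 <= Q by rewrite QE powR_ge0.
(* The factor [kap b] costs [2 ^ B] and [m] costs [2 ^ (3 * B)], together at most
   [x ^ (theta / 2)]. *)
have Qkm : Q <= kap b * m.
  apply: le_trans (_ : (1 / 2) ^+ (128 * dn ^ 2) * m <= _); last by rewrite ler_wpM2r.
  rewrite /m mulrCA -exprD -mulSn div1r exprVn ler_pdivlMr ?exprn_gt0//.
  apply: le_trans (_ : Q * x `^ (theta / 2) <= _); first by rewrite ler_wpM2l.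
  by move: xQ xn; clear; lra.
have Qm : Q <= m.
  by apply: le_trans Qkm _; rewrite ler_piMl// (kap_le1 bb k1 Hb).
have e2 : 4 / m <= L^-1.
  have mpos : 0 < m by move: Qm LQ L0; clear; lra.
  by rewrite ler_pdivrMr// ler_pdivlMl//; move: Qm LQ; clear; lra.
have e3 : expR (#|U|%:R * (ln 2 / k) + t - kap b * (m / 4)) <= L^-1 * 2 ^+ (2 * n - 2).
  rewrite twoN Linv -expRD ler_expR.
  have h : #|U|%:R * (ln 2 / k) <= x * ln 2 + x `^ delta.
    apply: le_trans (_ : (k * x + x `^ delta) * (ln 2 / k) <= _).
      by rewrite ler_wpM2r ?divr_ge0 ?(ltW k0)//; apply: le_trans Ul lk.
    have -> : (k * x + x `^ delta) * (ln 2 / k) = x * ln 2 + x `^ delta * (ln 2 / k).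
      by field; rewrite gt_eqF.
    rewrite lerD2l ler_piMr ?powR_ge0// ler_pdivrMr// mul1r.
    exact: le_trans k1.
  by move: h Qkm dQ lnL; clear; lra.
have p0 : 0 < (p%:R : R) by rewrite ltr0n prime_gt0.
have e4 : expR (- (2 * kap b / p%:R ^+ 2 * (m / 4))) * p%:R <= L^-1 ^+ 2.
  have pexp : p%:R <= expR (ln c2 + L).
    rewrite expRD LE !lnK ?posrE//; apply: le_trans pc2 _.
    by rewrite ler_pM2l.
  have Lexp : L^-1 ^+ 2 = expR (- (2 * ln L)).
    by rewrite Linv -expRM_natl mulrN.
  apply: le_trans (_ : expR (- (2 * kap b / p%:R ^+ 2 * (m / 4))) * expR (ln c2 + L) <= _).
    by rewrite ler_pM2l ?expR_gt0.
  rewrite Lexp -expRD ler_expR.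
  have lnc2 : ln c2 <= c2 - 1 by apply: ln_le_sub1.
  (* The exponent has to absorb [ln p <= ln c2 + L] and [2 * ln L <= 2 * L]. *)
  have h : c2 + 3 * L <= 2 * kap b / p%:R ^+ 2 * (m / 4).
    have -> : 2 * kap b / p%:R ^+ 2 * (m / 4) = kap b * m / (2 * p%:R ^+ 2).
      by field; rewrite gt_eqF.
    rewrite ler_pdivlMr ?mulr_gt0 ?exprn_gt0//.
    apply: le_trans Qkm; apply: le_trans cQ.
    rewrite ler_wpM2l//; first by move: c20 L0; clear; lra.
    rewrite ler_pM2l// ler_sqr ?nnegrE ?(ltW p0)//.
    by rewrite mulr_ge0 ?powR_ge0// ltW.
  by move: h lnc2 lnL; clear; lra.
have pinv : p%:R^-1 <= L^-1.
  by rewrite lef_pV2 ?posrE//; apply: le_trans La pc1.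
have := tvd_many_inputs bb k1 Hb dep_ok dn0 card_dep n_large p_pr p_odd p_large
  nU t0 e1 e2 e3 Li0 e4.
by move: pinv; clear; lra.
Qed.
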